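(* Let $H$ be a Hopf algebra with bijective antipode over a field $k$, and let $A$ be a right $H$-comodule algebra. (1) Let $M$ be a right-right stable anti-Yetter-Drinfeld module over $H$. Then the formulas $$(\delta_if)(a_0\otimes\dots\otimes a_n)=f(a_0\otimes\dots\otimes a_ia_{i+1}\otimes\dots\otimes a_n),\quad 0\le i<n,$$ $$(\delta_nf)(a_0\otimes\dots\otimes a_n)=f(a_n^{(0)}a_0\otimes a_1\otimes\dots\otimes a_{n-1})\,a_n^{(1)},$$ $$(\sigma_if)(a_0\otimes\dots\otimes a_n)=f(a_0\otimes\dots\otimes a_i\otimes1\otimes a_{i+1}\otimes\dots\otimes a_n),\quad 0\le i\le n,$$ $$(\tau_nf)(a_0\otimes\dots\otimes a_n)=f(a_n^{(0)}\otimes a_0\otimes\dots\otimes a_{n-1})\,a_n^{(1)}$$ define a (co)cyclic module structure on $\{\mathrm{Hom}^H(A^{\otimes(n+1)},M)\}_{n\in\mathbb N}$. (2) Let $M$ be a left-left stable anti-Yetter-Drinfeld module over $H$. Then the formulas $$d_i(a_0\otimes\dots\otimes a_n\otimes m)=a_0\otimes\dots\otimes a_ia_{i+1}\otimes\dots\otimes a_n\otimes m,\quad 0\le i<n,$$ $$d_n(a_0\otimes\dots\otimes a_n\otimes m)=a_n^{(0)}a_0\otimes a_1\otimes\dots\otimes a_{n-1}\otimes a_n^{(1)}m,$$ $$s_i(a_0\otimes\dots\otimes a_n\otimes m)=a_0\otimes\dots\otimes a_i\otimes1\otimes a_{i+1}\otimes\dots\otimes a_n\otimes m,\quad 0\le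 i\le n,$$ $$t_n(a_0\otimes\dots\otimes a_n\otimes m)=a_n^{(0)}\otimes a_0\otimes\dots\otimes a_{n-1}\otimes a_n^{(1)}m$$ define a cyclic module structure on $\{A^{\otimes(n+1)}\,\square_H\,M\}_{n\in\mathbb N}$.
   Context: All algebras are associative and unital over $k$; $\otimes=\otimes_k$; $\mathbb N=\{0,1,2,\dots\}$. $H$ has coproduct $\Delta(h)=h^{(1)}\otimes h^{(2)}$, counit $\varepsilon$, antipode $S$. Right coactions are written $\Delta_M(m)=m^{(0)}\otimes m^{(1)}$, left coactions ${}_M\Delta(m)=m^{(-1)}\otimes m^{(0)}$ (summation suppressed). A right-right anti-Yetter-Drinfeld module is a right $H$-module and right $H$-comodule $M$ with $\Delta_M(mh)=m^{(0)}h^{(2)}\otimes S^{-1}(h^{(1)})m^{(1)}h^{(3)}$; it is stable if $m^{(0)}m^{(1)}=m$ for all $m$. A left-left anti-Yetter-Drinfeld module is a left $H$-module and left $H$-comodule $M$ with ${}_M\Delta(hm)=h^{(1)}m^{(-1)}S^{-1}(h^{(3)})\otimes h^{(2)}m^{(0)}$; it is stable if $m^{(-1)}m^{(0)}=m$ for all $m$. A right $H$-comodule algebra is an algebra $A$ that is a right $H$-comodule whose coaction $A\to A\otimes H$ is an algebra homomorphism. $A^{\otimes(n+1)}$ is a right $H$-comodule via the diagonal coaction $a_0\otimes\dots\otimes a_n\mapsto a_0^{(0)}\otimes\dots\otimes a_n^{(0)}\otimes a_0^{(1)}\cdots a_n^{(1)}$. $\mathrm{Hom}^H$ denotes right $H$-colinear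 maps. For a right comodule $X$ and a left comodule $Y$, $X\square_HY:=\mathrm{Ker}(\Delta_X\otimes\mathrm{id}-\mathrm{id}\otimes{}_Y\Delta)\subseteq X\otimes Y$. The formulas in (2) are understood on linear combinations lying in the cotensor product. In (1), with $\mathcal C^n=\mathrm{Hom}^H(A^{\otimes(n+1)},M)$, the maps are $\delta_i:\mathcal C^{n-1}\to\mathcal C^n$, $\sigma_i:\mathcal C^{n+1}\to\mathcal C^n$, $\tau_n:\mathcal C^n\to\mathcal C^n$; ''(co)cyclic module structure'' means that these maps are well defined, $\delta_i,\sigma_i$ satisfy the cosimplicial identities, and $\tau_n\delta_i=\delta_{i-1}\tau_{n-1}$ ($1\le i\le n$), $\tau_n\delta_0=\delta_n$, $\tau_n\sigma_i=\sigma_{i-1}\tau_{n+1}$ ($1\le i\le n$), $\tau_n\sigma_0=\sigma_n\tau_{n+1}^2$, $\tau_n^{n+1}=\mathrm{id}$. In (2), with $\mathcal C_n=A^{\otimes(n+1)}\square_HM$, the maps are $d_i:\mathcal C_n\to\mathcal C_{n-1}$ ($n\ge1$), $s_i:\mathcal C_n\to\mathcal C_{n+1}$, $t_n:\mathcal C_n\to\mathcal C_n$; ''cyclic module structure'' means that these maps are well defined, $d_i,s_i$ satisfy the simplicial identities, and $d_it_n=t_{n-1}d_{i-1}$ ($1\le i\le n$), $d_0t_n=d_n$, $s_it_n=t_{n+1}s_{i-1}$ ($1\le i\le n$), $s_0t_n=t_{n+1}^2s_n$, $t_n^{n+1}=\mathrm{id}$. *)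

(* Defs.v *)
From HB Require Import structures.
From mathcomp Require Import all_boot all_order all_algebra.
From mathcomp Require Import generic_quotient.
From mathcomp Require Import boolp functions.

Set Implicit Arguments.
Unset Strict Implicit.
Unset Printing Implicit Defensive.

Import GRing.Theory.
Local Open Scope ring_scope.
Local Open Scope quotient_scope.

(** * Tensor product of two vector spaces

    [tensor U V] is the quotient of the free commutative monoid of formal finite
    sums of pairs (lists up to reordering) by the bilinearity relations. *)

Section Tensor.
Variables (k : fieldType) (U V : lmodType k).

Inductive tens_eqv : seq (U * V) -> seq (U * V) -> Prop :=
| Tens_refl s : tens_eqv s s
| Tens_sym s t : tens_eqv s t -> tens_eqv t s
| Tens_trans s t r : tens_eqv s t -> tens_eqv t r -> tens_eqv s r
| Tens_cat s s' t t' :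
    tens_eqv s s' -> tens_eqv t t' -> tens_eqv (s ++ t) (s' ++ t')
| Tens_comm s t : tens_eqv (s ++ t) (t ++ s)
| Tens_addl u u' v : tens_eqv [:: (u + u', v)] [:: (u, v); (u', v)]
| Tens_addr u v v' : tens_eqv [:: (u, v + v')] [:: (u, v); (u, v')]
| Tens_scale (c : k) u v : tens_eqv [:: (c *: u, v)] [:: (u, c *: v)]
| Tens_zero : tens_eqv [:: (0, 0)] [::].

Definition tens_rel : rel (seq (U * V)) := fun s t => `[< tens_eqv s t >].

Lemma tens_rel_refl : reflexive tens_rel.
Proof. by move=> s; apply/asboolP; exact: Tens_refl. Qed.

Lemma tens_rel_sym : symmetric tens_rel.
Proof. by move=> s t; apply/asboolP/asboolP; exact: Tens_sym. Qed.

Lemma tens_rel_trans : transitive tens_rel.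
Proof.
move=> t s r /asboolP st /asboolP tr; apply/asboolP; exact: Tens_trans st tr.
Qed.

Canonical tens_equiv := EquivRel tens_rel tens_rel_refl tens_rel_sym tens_rel_trans.

Definition tensor : Type := {eq_quot tens_equiv}.
HB.instance Definition _ := Choice.on tensor.
HB.instance Definition _ := EqQuotient.on tensor.

Implicit Types (s t : seq (U * V)) (x y z : tensor).

Let cls s : tensor := \pi_tensor s.

Local Lemma clsP s t : cls s = cls t <-> tens_eqv s t.
Proof. by split=> [/eqmodP/asboolP|st]; last by apply/eqmodP/asboolP. Qed.

Local Lemma cls_ind (P : tensor -> Prop) : (forall s, P (cls s)) -> forall x, P x.
Proof. by move=> Ps x; rewrite -[x]reprK; exact: Ps. Qed.

Local Lemma repr_cls s : tens_eqv (repr (cls s)) s.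
Proof. by apply/clsP; rewrite /cls reprK. Qed.

Let scs (c : k) s := [seq (c *: p.1, p.2) | p <- s].

Local Lemma eqv_zl v : tens_eqv [:: (0, v)] [::].
Proof.
apply: (Tens_trans _ Tens_zero).
by have := Tens_scale 0 0 v; rewrite !scale0r.
Qed.

Local Lemma eqv_scs c s t : tens_eqv s t -> tens_eqv (scs c s) (scs c t).
Proof.
rewrite /scs; elim=> {s t} /=.
- by move=> s; exact: Tens_refl.
- by move=> s t _; exact: Tens_sym.
- by move=> s t r _ st _; exact: Tens_trans.
- by move=> s s' t t' _ ss' _ tt'; rewrite !map_cat; exact: Tens_cat.
- by move=> s t; rewrite !map_cat; exact: Tens_comm.
- by move=> u u' v; rewrite scalerDr; exact: Tens_addl.
- by move=> u v v'; exact: Tens_addr.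
- by move=> b u v; rewrite scalerA mulrC -scalerA; exact: Tens_scale.
- by rewrite scaler0; exact: Tens_zero.
Qed.

Local Definition tadd x y : tensor := cls (repr x ++ repr y).
Local Definition tscale c x : tensor := cls (scs c (repr x)).
Local Definition tzero : tensor := cls [::].
Local Definition topp x : tensor := tscale (-1) x.

Local Lemma taddE s t : tadd (cls s) (cls t) = cls (s ++ t).
Proof. by apply/clsP/Tens_cat; exact: repr_cls. Qed.

Local Lemma tscaleE c s : tscale c (cls s) = cls (scs c s).
Proof. by apply/clsP/eqv_scs; exact: repr_cls. Qed.

Local Lemma taddA : associative tadd.
Proof.
elim/cls_ind=> s; elim/cls_ind=> t; elim/cls_ind=> r.
by rewrite !taddE catA.
Qed.

Local Lemma taddC : commutative tadd.
Proof.
elim/cls_ind=> s; elim/cls_ind=> t.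
by rewrite !taddE; apply/clsP; exact: Tens_comm.
Qed.

Local Lemma tadd0 : left_id tzero tadd.
Proof. by elim/cls_ind=> s; rewrite taddE. Qed.

Local Lemma eqv_scsD a b s : tens_eqv (scs (a + b) s) (scs a s ++ scs b s).
Proof.
elim: s => [|[u v] s IHs] /=; first exact: Tens_refl.
rewrite -[_ :: scs (a + b) s]cat1s -[_ :: (_ ++ _)]cat1s.
have hd : tens_eqv [:: ((a + b) *: u, v)] ([:: (a *: u, v)] ++ [:: (b *: u, v)]).
  by rewrite scalerDl; exact: Tens_addl.
apply: (Tens_trans (Tens_cat hd IHs)).
rewrite -!catA; apply: Tens_cat; first exact: Tens_refl.
rewrite -[(b *: u, v) :: scs b s]cat1s !catA; apply: Tens_cat (Tens_refl _).
exact: Tens_comm.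
Qed.

Local Lemma eqv_scs0 s : tens_eqv (scs 0 s) [::].
Proof.
elim: s => [|[u v] s IHs] /=; first exact: Tens_refl.
rewrite scale0r -[_ :: _]cat1s -[X in tens_eqv _ X](cats0 [::]).
by apply: Tens_cat IHs; exact: eqv_zl.
Qed.

Local Lemma scs1 s : scs 1 s = s.
Proof. by elim: s => [|[u v] s IHs] //=; rewrite scale1r IHs. Qed.

Local Lemma taddN : left_inverse tzero topp tadd.
Proof.
elim/cls_ind=> s; rewrite /topp tscaleE taddE -{2}[s]scs1; apply/clsP.
apply: (Tens_trans (Tens_sym (eqv_scsD _ _ _))).
by rewrite addNr; exact: eqv_scs0.
Qed.

HB.instance Definition _ :=
  GRing.isZmodule.Build tensor taddA taddC tadd0 taddN.

Local Lemma tscaleA a b x : tscale a (tscale b x) = tscale (a * b) x.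
Proof.
elim/cls_ind: x => s; rewrite !tscaleE; congr cls.
by rewrite /scs -map_comp; apply: eq_map => p /=; rewrite scalerA.
Qed.

Local Lemma tscale1 : left_id 1 tscale.
Proof. by elim/cls_ind=> s; rewrite tscaleE scs1. Qed.

Local Lemma tscaleDr : right_distributive tscale +%R.
Proof.
move=> c; elim/cls_ind=> s; elim/cls_ind=> t.
by rewrite [LHS](congr1 (tscale c) (taddE s t)) !tscaleE /scs map_cat -taddE.
Qed.

Local Lemma tscaleDl x : {morph tscale^~ x : a b / a + b}.
Proof.
move=> a b; elim/cls_ind: x => s; rewrite !tscaleE.
by rewrite [RHS](taddE (scs a s)); apply/clsP; exact: eqv_scsD.
Qed.

HB.instance Definition _ :=
  GRing.Zmodule_isLmodule.Build k tensor tscaleA tscale1 tscaleDr tscaleDl.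

Definition pure (u : U) (v : V) : tensor := \pi_tensor [:: (u, v)].

Definition bilin (W : lmodType k) (F : U -> V -> W) : Prop :=
  (forall v, linear (F^~ v)) /\ (forall u, linear (F u)).

(** If [x] is written in Sweedler notation as [x1 (x) x2], then [sweedler x F]
    is the (implicit) sum [F x1 x2]: a finite sum over some decomposition of
    [x] into pure tensors, which does not depend on the decomposition when [F]
    is bilinear ([sweedler_pure], [sweedler_linear]). *)
Definition sweedler (W : lmodType k) (x : tensor) (F : U -> V -> W) : W :=
  \sum_(p <- repr x) F p.1 p.2.

Lemma pure_bilin : bilin pure.
Proof.
have addE s t : cls s + cls t = cls (s ++ t) := taddE s t.
have scaleE c s : c *: cls s = cls (scs c s) := tscaleE c s.
split=> [v a u u'|u a v v']; rewrite /pure -!/(cls _) scaleE addE; apply/clsP.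
  exact: Tens_addl.
apply: (Tens_trans (Tens_addr _ _ _)).
rewrite -cat1s; apply: Tens_cat (Tens_refl _).
exact/Tens_sym/Tens_scale.
Qed.

Lemma tensor_decomp x : exists s, x = \sum_(p <- s) pure p.1 p.2.
Proof.
elim/cls_ind: x => s; exists s; elim: s => [|[u v] s IHs]; first by rewrite big_nil.
by rewrite big_cons -IHs -cat1s -taddE.
Qed.

Lemma tensor_ind (P : tensor -> Prop) : P 0 -> (forall u v, P (pure u v)) ->
  (forall x y, P x -> P y -> P (x + y)) -> forall x, P x.
Proof.
move=> P0 Pp PD x; have [s ->] := tensor_decomp x.
by apply: big_ind => // p _; exact: Pp.
Qed.

Section Universal.
Variables (W : lmodType k) (F : U -> V -> W).
Hypothesis bF : bilin F.

Local Lemma sum_eqv s t : tens_eqv s t ->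
  \sum_(p <- s) F p.1 p.2 = \sum_(p <- t) F p.1 p.2.
Proof.
case: bF => Fl Fr.
have FDl u u' v : F (u + u') v = F u v + F u' v.
  by have := Fl v 1 u u'; rewrite !scale1r.
have FDr u v v' : F u (v + v') = F u v + F u v'.
  by have := Fr u 1 v v'; rewrite !scale1r.
have F0l v : F 0 v = 0 by apply: (addrI (F 0 v)); rewrite -FDl !addr0.
have F0r u : F u 0 = 0 by apply: (addrI (F u 0)); rewrite -FDr !addr0.
have FZl c u v : F (c *: u) v = c *: F u v.
  by have := Fl v c u 0; rewrite F0l !addr0.
have FZr c u v : F u (c *: v) = c *: F u v.
  by have := Fr u c v 0; rewrite F0r !addr0.
elim=> {s t} //=.
- by move=> s t r _ -> _ ->.
- by move=> s s' t t' _ ss' _ tt'; rewrite !big_cat /= ss' tt'.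
- by move=> s t; rewrite !big_cat /= addrC.
- by move=> u u' v; rewrite !big_cons !big_nil !addr0 FDl.
- by move=> u v v'; rewrite !big_cons !big_nil !addr0 FDr.
- by move=> c u v; rewrite !big_cons !big_nil !addr0 FZl FZr.
- by rewrite big_cons !big_nil F0l addr0.
Qed.

Lemma sweedler_pure u v : sweedler (pure u v) F = F u v.
Proof.
by rewrite /sweedler (sum_eqv (repr_cls [:: (u, v)])) big_cons big_nil addr0.
Qed.

Lemma sweedler_linear : linear (fun x => sweedler x F).
Proof.
move=> c; elim/cls_ind=> s; elim/cls_ind=> t.
have -> : c *: cls s + cls t = cls (scs c s ++ t).
  by rewrite [c *: _](tscaleE c s) [LHS]taddE.
rewrite /sweedler !(sum_eqv (repr_cls _)) big_cat /= big_map scaler_sumr.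
congr (_ + _); apply: eq_bigr => p _ /=.
have F0 : F 0 p.2 = 0.
  by apply: (addrI (F 0 p.2)); have := bF.1 p.2 1 0 0; rewrite !scale1r !addr0.
by have := bF.1 p.2 c p.1 0; rewrite F0 !addr0.
Qed.

End Universal.

End Tensor.

Arguments pure {k U V} u v.
Arguments sweedler {k U V W} x F.
Notation "u ⊗ v" := (pure u v) (at level 40, left associativity) : ring_scope.

Section TensorMaps.
Variable k : fieldType.

Lemma pureDl (U V : lmodType k) (u u' : U) (v : V) : (u + u') ⊗ v = u ⊗ v + u' ⊗ v.
Proof. by have := (pure_bilin U V).1 v 1 u u'; rewrite !scale1r. Qed.

Lemma pureZl (U V : lmodType k) (c : k) (u : U) (v : V) : (c *: u) ⊗ v = c *: (u ⊗ v).
Proof.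
have := (pure_bilin U V).1 v c u 0; rewrite !addr0 => ->.
suff -> : (0 : U) ⊗ v = 0 by rewrite addr0.
by apply: (addrI ((0 : U) ⊗ v)); rewrite -pureDl !addr0.
Qed.

Lemma pureDr (U V : lmodType k) (u : U) (v v' : V) : u ⊗ (v + v') = u ⊗ v + u ⊗ v'.
Proof. by have := (pure_bilin U V).2 u 1 v v'; rewrite !scale1r. Qed.

Lemma pureZr (U V : lmodType k) (c : k) (u : U) (v : V) : u ⊗ (c *: v) = c *: (u ⊗ v).
Proof.
have := (pure_bilin U V).2 u c v 0; rewrite !addr0 => ->.
suff -> : u ⊗ (0 : V) = 0 by rewrite addr0.
by apply: (addrI (u ⊗ (0 : V))); rewrite -pureDr !addr0.
Qed.

Definition tmap (U V U' V' : lmodType k) (f : U -> U') (g : V -> V')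
  (x : tensor U V) : tensor U' V' := sweedler x (fun u v => f u ⊗ g v).

Definition tassoc (U V W : lmodType k) (x : tensor U (tensor V W)) :
    tensor (tensor U V) W :=
  sweedler x (fun u y => sweedler y (fun v w => (u ⊗ v) ⊗ w)).

Lemma sweedler_sum (U V W : lmodType k) (F : U -> V -> W) (I : Type) (r : seq I)
    (G : I -> tensor U V) : bilin F ->
  sweedler (\sum_(i <- r) G i) F = \sum_(i <- r) sweedler (G i) F.
Proof.
move=> bF; have L := sweedler_linear bF.
have Z : sweedler 0 F = 0.
  apply: (addrI (sweedler 0 F)).
  by have := L 1 0 0; rewrite !scale1r !addr0.
elim: r => [|i r IHr]; first by rewrite !big_nil.
by rewrite !big_cons -IHr; have := L 1 (G i) (\sum_(j <- r) G j); rewrite !scale1r.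
Qed.

Lemma tmap_bilin (U V U' V' : lmodType k) (f : U -> U') (g : V -> V') :
  linear f -> linear g -> bilin (fun u v => f u ⊗ g v).
Proof.
move=> fL gL; split=> [v c u u'|u c v v'].
  by rewrite fL pureDl pureZl.
by rewrite gL pureDr pureZr.
Qed.

Lemma tmap_linear (U V U' V' : lmodType k) (f : U -> U') (g : V -> V') :
  linear f -> linear g -> linear (tmap f g).
Proof. by move=> fL gL; exact/sweedler_linear/tmap_bilin. Qed.

Lemma tassoc_linear (U V W : lmodType k) : linear (@tassoc U V W).
Proof.
have bi u : bilin (fun (v : V) (w : W) => (u ⊗ v : tensor U V) ⊗ w).
  split=> [w c v v'|v c w w'].
    by rewrite pureDr pureZr pureDl pureZl.
  by rewrite pureDr pureZr.
apply: sweedler_linear; split=> [y c u u'|u]; last exact: sweedler_linear.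
rewrite /sweedler scaler_sumr -big_split; apply: eq_bigr => p _ /=.
by rewrite !pureDl !pureZl.
Qed.

End TensorMaps.

(** * Algebras and Hopf algebras

    The library's [algType] requires [1 != 0].  This is no restriction for Hopf
    algebras, whose counit maps [1] to [1 != 0] in [k]; a comodule algebra may
    however be zero, hence the separate structure [algebra]. *)

Record algebra (k : fieldType) := Algebra {
  alg_sort :> lmodType k;
  amul : alg_sort -> alg_sort -> alg_sort;
  aone : alg_sort;
  amul_bilin : bilin amul;
  amulA : associative amul;
  amul1l : left_id aone amul;
  amul1r : right_id aone amul
}.

Arguments amul {k a} x y : rename.
Arguments aone {k a}.

Record hopfAlgebra (k : fieldType) := HopfAlgebra {
  hopf_sort :> algType k;
  comul : {linear hopf_sort -> tensor hopf_sort hopf_sort};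
  counit : {scalar hopf_sort};
  antipode : {linear hopf_sort -> hopf_sort};
  comulA : forall h, tassoc (tmap id comul (comul h)) = tmap comul id (comul h);
  counitl : forall h, sweedler (comul h) (fun h1 h2 => counit h1 *: h2) = h;
  counitr : forall h, sweedler (comul h) (fun h1 h2 => counit h2 *: h1) = h;
  comul1 : comul 1 = 1 ⊗ 1;
  comulM : forall g h, comul (g * h) =
    sweedler (comul g) (fun g1 g2 =>
      sweedler (comul h) (fun h1 h2 => (g1 * h1) ⊗ (g2 * h2)));
  counit1 : counit 1 = 1;
  counitM : forall g h, counit (g * h) = counit g * counit h;
  antipodel : forall h,
    sweedler (comul h) (fun h1 h2 => antipode h1 * h2) = (counit h)%:A;
  antipoder : forall h,
    sweedler (comul h) (fun h1 h2 => h1 * antipode h2) = (counit h)%:A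
}.

Section Coactions.
Variables (k : fieldType) (H : hopfAlgebra k).

(** [sweedler3 h F] is [F h1 h2 h3] for the iterated coproduct
    [h1 (x) h2 (x) h3] of [h]. *)
Definition sweedler3 (W : lmodType k) (h : H) (F : H -> H -> H -> W) : W :=
  sweedler (comul H h) (fun h1 h' =>
    sweedler (comul H h') (fun h2 h3 => F h1 h2 h3)).

Definition is_rcoaction (X : lmodType k) (rho : X -> tensor X H) : Prop :=
  (forall x, tassoc (tmap id (comul H) (rho x)) = tmap rho id (rho x)) /\
  (forall x, sweedler (rho x) (fun x0 x1 => counit H x1 *: x0) = x).

Definition is_lcoaction (X : lmodType k) (lam : X -> tensor H X) : Prop :=
  (forall x, tassoc (tmap id lam (lam x)) = tmap (comul H) id (lam x)) /\
  (forall x, sweedler (lam x) (fun x1 x0 => counit H x1 *: x0) = x).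

Record comodAlgebra := ComodAlgebra {
  comodalg_alg :> algebra k;
  coact : {linear comodalg_alg -> tensor comodalg_alg H};
  coactP : is_rcoaction coact;
  coact1 : coact aone = aone ⊗ 1;
  coactM : forall a b, coact (amul a b) =
    sweedler (coact a) (fun a0 a1 =>
      sweedler (coact b) (fun b0 b1 => amul a0 b0 ⊗ (a1 * b1)))
}.

Record rmodComod := RmodComod {
  rmc_sort :> lmodType k;
  ract : rmc_sort -> H -> rmc_sort;
  ract_bilin : bilin ract;
  ract1 : forall m, ract m 1 = m;
  ractM : forall m g h, ract m (g * h) = ract (ract m g) h;
  rcoact : {linear rmc_sort -> tensor rmc_sort H};
  rcoactP : is_rcoaction rcoact
}.

Record lmodComod := LmodComod {
  lmc_sort :> lmodType k;
  lact : H -> lmc_sort -> lmc_sort;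
  lact_bilin : bilin lact;
  lact1 : forall m, lact 1 m = m;
  lactM : forall g h m, lact (g * h) m = lact g (lact h m);
  lcoact : {linear lmc_sort -> tensor H lmc_sort};
  lcoactP : is_lcoaction lcoact
}.

Definition is_rAYD (Sinv : H -> H) (M : rmodComod) : Prop :=
  forall (m : M) (h : H), rcoact M (ract m h) =
    sweedler (rcoact M m) (fun m0 m1 =>
      sweedler3 h (fun h1 h2 h3 => ract m0 h2 ⊗ (Sinv h1 * m1 * h3))).

Definition rstable (M : rmodComod) : Prop :=
  forall m : M, sweedler (rcoact M m) (fun m0 m1 => ract m0 m1) = m.

(** Here [m1] stands for [m^(-1)]. *)
Definition is_lAYD (Sinv : H -> H) (M : lmodComod) : Prop :=
  forall (h : H) (m : M), lcoact M (lact h m) =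
    sweedler (lcoact M m) (fun m1 m0 =>
      sweedler3 h (fun h1 h2 h3 => (h1 * m1 * Sinv h3) ⊗ lact h2 m0)).

Definition lstable (M : lmodComod) : Prop :=
  forall m : M, sweedler (lcoact M m) (fun m1 m0 => lact m1 m0) = m.

End Coactions.

(** * Tensor powers of a comodule algebra *)

Section TensorPower.
Variables (k : fieldType) (H : hopfAlgebra k) (A : comodAlgebra H).

(** [tpow n] is the [n+1]-fold tensor power of [A], bracketed to the left. *)
Fixpoint tpow (n : nat) : lmodType k :=
  if n is n'.+1 then (tensor (tpow n') A : lmodType k) else (A : lmodType k).

(** [tpure n a] is [a 0 ⊗ ... ⊗ a n]; the values of [a] beyond [n] are unused. *)
Fixpoint tpure (n : nat) (a : nat -> A) : tpow n :=
  match n return tpow n with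
  | 0 => a 0
  | n'.+1 => tpure n' a ⊗ a n'.+1
  end.

(** The diagonal coaction: [a_0 ⊗ ... ⊗ a_n] is mapped to
    [(a_0^(0) ⊗ ... ⊗ a_n^(0)) ⊗ a_0^(1) ... a_n^(1)]. *)
Fixpoint tcoact (n : nat) : tpow n -> tensor (tpow n) H :=
  match n return tpow n -> tensor (tpow n) H with
  | 0 => coact A
  | n'.+1 => fun x => sweedler x (fun y b =>
      sweedler (tcoact y) (fun y0 y1 =>
        sweedler (coact A b) (fun b0 b1 => (y0 ⊗ b0) ⊗ (y1 * b1))))
  end.

Lemma tcoact_bilin (X : lmodType k) (f : X -> tensor X H) : linear f ->
  bilin (fun x (b : A) => sweedler (f x) (fun x0 x1 =>
    sweedler (coact A b) (fun b0 b1 => (x0 ⊗ b0 : tensor X A) ⊗ (x1 * b1)))).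
Proof.
move=> fL; split=> [b|x].
  have B : bilin (fun x0 x1 => sweedler (coact A b) (fun b0 b1 =>
      (x0 ⊗ b0 : tensor X A) ⊗ (x1 * b1))).
    split=> [x1 c x x'|x0 c h h']; rewrite /sweedler scaler_sumr -big_split;
      apply: eq_bigr => p _ /=.
      by rewrite !pureDl !pureZl.
    by rewrite mulrDl -scalerAl pureDr pureZr.
  by move=> c y y'; rewrite fL; exact: sweedler_linear.
have B x0 (x1 : H) : bilin (fun b0 (b1 : H) => (x0 ⊗ b0 : tensor X A) ⊗ (x1 * b1)).
  split=> [h a d d'|d a h h'].
    by rewrite pureDr pureZr pureDl pureZl.
  by rewrite mulrDr -(scalerAr a x1 h) pureDr pureZr.
move=> c b b'; rewrite linearP [LHS]/sweedler.
rewrite (eq_bigr _ (fun p _ => sweedler_linear (B p.1 p.2) c _ _)).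
by rewrite big_split -scaler_sumr.
Qed.

Fact tcoact_linear n : linear (@tcoact n).
Proof.
elim: n => [|n IHn] /=; first exact: linearP.
exact/sweedler_linear/tcoact_bilin.
Qed.

HB.instance Definition _ n :=
  GRing.isLinear.Build k (tpow n) (tensor (tpow n) H) *:%R (@tcoact n)
    (@tcoact_linear n).

Lemma tpure_eq n (a b : nat -> A) :
  (forall i, (i <= n)%N -> a i = b i) -> tpure n a = tpure n b.
Proof.
elim: n => [|n IHn] eab /=; first exact: eab.
by rewrite eab // IHn // => i /leqW; exact: eab.
Qed.

Lemma tpow_decomp n (x : tpow n) : exists s, x = \sum_(a <- s) tpure n a.
Proof.
elim: n x => [|n IHn] x; first by exists [:: fun=> x]; rewrite big_seq1.
elim/tensor_ind: x => [|y b|_ _ [s ->] [t ->]].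
- by exists [::]; rewrite big_nil.
- have [s ->] := IHn y.
  exists [seq (fun i => if i == n.+1 then b else a i) | a <- s].
  rewrite big_map; elim: s => [|a s IHs].
    rewrite !big_nil; apply: (addrI (0 ⊗ b)).
    by rewrite -pureDl !addr0.
  rewrite !big_cons pureDl IHs /= eqxx; congr (_ ⊗ _ + _).
  by apply: tpure_eq => i; rewrite -ltnS; case: ltngtP.
- by exists (s ++ t); rewrite big_cat.
Qed.

Lemma tpow_tensor_decomp n (M : lmodType k) (x : tensor (tpow n) M) :
  exists s : seq ((nat -> A) * M), x = \sum_(p <- s) tpure n p.1 ⊗ p.2.
Proof.
elim/tensor_ind: x => [|y m|_ _ [s ->] [t ->]].
- by exists [::]; rewrite big_nil.
- have [s ->] := tpow_decomp y; exists [seq (a, m) | a <- s].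
  rewrite big_map; elim: s => [|a s IHs]; last by rewrite !big_cons pureDl IHs.
  by rewrite !big_nil; apply: (addrI (0 ⊗ m)); rewrite -pureDl !addr0.
- by exists (s ++ t); rewrite big_cat.
Qed.

(** Operations on families [a_0, a_1, ...]: replacing [a_i, a_(i+1)] by their
    product, inserting [1] after [a_i], prepending [b], and multiplying [a_0]
    by [b] on the left. *)
Definition fmerge (i : nat) (a : nat -> A) (j : nat) : A :=
  if (j < i)%N then a j else if j == i then amul (a i) (a i.+1) else a j.+1.

Definition finsert1 (i : nat) (a : nat -> A) (j : nat) : A :=
  if (j <= i)%N then a j else if j == i.+1 then aone else a j.-1.

Definition fcons (b : A) (a : nat -> A) (j : nat) : A :=
  if j is j'.+1 then a j' else b.

Definition fmulhead (b : A) (a : nat -> A) (j : nat) : A :=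
  if j is 0 then amul b (a 0) else a j.

End TensorPower.

Arguments tpow {k H} A n.
Arguments tpure {k H A} n a.
Arguments tcoact {k H} A n x.

(** * Colinear maps *)

Section Colinear.
Variables (k : fieldType) (H : hopfAlgebra k) (X Y : lmodType k).
Variables (rhoX : {linear X -> tensor X H}) (rhoY : {linear Y -> tensor Y H}).

Definition colinear : {pred X -> Y} := fun f =>
  `[< linear f /\ forall x, rhoY (f x) = tmap f id (rhoX x) >].

Fact colinear_closed : submod_closed colinear.
Proof.
split=> [|c f g /asboolP[fL fC] /asboolP[gL gC]].
  apply/asboolP; split=> [c x y|x]; first by rewrite /= scaler0 addr0.
  rewrite linear0 /tmap /sweedler big1 // => p _.
  by apply: (addrI (0 ⊗ p.2)); rewrite -pureDl !addr0.
apply/asboolP; split=> [b x y|x].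
  rewrite -[LHS]/(c *: f (b *: x + y) + g (b *: x + y)) fL gL.
  rewrite -[in RHS]/(b *: (c *: f x + g x) + (c *: f y + g y)).
  by rewrite !scalerDr addrACA !scalerA mulrC.
rewrite -[LHS]/(rhoY (c *: f x + g x)) linearP fC gC scaler_sumr -big_split.
by apply: eq_bigr => p _ /=; rewrite -pureZl -pureDl.
Qed.

HB.instance Definition _ :=
  GRing.isSubmodClosed.Build k (X -> Y) colinear colinear_closed.

Record colinMap := ColinMap {
  colin_fun :> X -> Y;
  colin_funP : colin_fun \in colinear
}.

HB.instance Definition _ := [isSub for colin_fun].
HB.instance Definition _ := [Choice of colinMap by <:].
HB.instance Definition _ := [SubChoice_isSubLmodule of colinMap by <:].

End Colinear.

(** * Cotensor product *)

Section Cotensor.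
Variables (k : fieldType) (H : hopfAlgebra k) (X Y : lmodType k).
Variables (rho : {linear X -> tensor X H}) (lam : {linear Y -> tensor H Y}).

Definition cotensor_pred : {pred tensor X Y} := fun z =>
  tmap rho id z == tassoc (tmap id lam z).

Fact cotensor_closed : submod_closed cotensor_pred.
Proof.
have idL (W : lmodType k) : linear (id : W -> W) by [].
have L1 := tmap_linear (linearP rho) (idL Y).
have L2 : linear (fun z => tassoc (tmap (@id X) lam z)).
  by move=> c x y; rewrite tmap_linear //= ?tassoc_linear //; exact: linearP.
have E0 (W : lmodType k) (f : tensor X Y -> W) : linear f -> f 0 = 0.
  by move=> fL; apply: (addrI (f 0)); have := fL 1 0 0; rewrite !scale1r !addr0.
split=> [|c x y /eqP ex /eqP ey]; apply/eqP.
  by rewrite (E0 _ _ L1) [RHS](E0 _ _ L2).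
by rewrite L1 [RHS]L2 ex ey.
Qed.

HB.instance Definition _ :=
  GRing.isSubmodClosed.Build k (tensor X Y) cotensor_pred cotensor_closed.

Record cotensor := Cotensor {
  cotensor_val :> tensor X Y;
  cotensor_valP : cotensor_val \in cotensor_pred
}.

HB.instance Definition _ := [isSub for cotensor_val].
HB.instance Definition _ := [Choice of cotensor by <:].
HB.instance Definition _ := [SubChoice_isSubLmodule of cotensor by <:].

End Cotensor.

(** [Hom^H(A^(n+1), M)] and the cotensor product of [A^(n+1)] with [M]. *)

Definition homC (k : fieldType) (H : hopfAlgebra k) (A : comodAlgebra H)
    (M : rmodComod H) (n : nat) : lmodType k :=
  colinMap (tcoact A n) (rcoact M).

Definition cotC (k : fieldType) (H : hopfAlgebra k) (A : comodAlgebra H)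
    (M : lmodComod H) (n : nat) : lmodType k :=
  cotensor (tcoact A n) (lcoact M).

(** * Cyclic and cocyclic modules

    Faces and degeneracies are indexed by [nat]; only the indices in the ranges
    [i <= n.+1] for [delta n i], [d n i] and [i <= n] for [sigma n i], [s n i]
    are meaningful. *)

Record is_cocyclic (k : fieldType) (C : nat -> lmodType k)
    (delta : forall n, nat -> {linear C n -> C n.+1})
    (sigma : forall n, nat -> {linear C n.+1 -> C n})
    (tau : forall n, {linear C n -> C n}) : Prop := IsCocyclic {
  cocyc_deltadelta : forall n i j (f : C n), (i < j <= n.+2)%N ->
    delta n.+1 j (delta n i f) = delta n.+1 i (delta n j.-1 f);
  cocyc_sigmasigma : forall n i j (f : C n.+2), (i <= j <= n)%N ->
    sigma n j (sigma n.+1 i f) = sigma n i (sigma n.+1 j.+1 f);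
  cocyc_sigmadelta_lt : forall n i j (f : C n.+1), (i < j <= n.+1)%N ->
    sigma n.+1 j (delta n.+1 i f) = delta n i (sigma n j.-1 f);
  cocyc_sigmadelta_eq : forall n j (f : C n), (j <= n)%N ->
    sigma n j (delta n j f) = f;
  cocyc_sigmadelta_eqS : forall n j (f : C n), (j <= n)%N ->
    sigma n j (delta n j.+1 f) = f;
  cocyc_sigmadelta_gt : forall n i j (f : C n.+1), (j.+1 < i <= n.+2)%N ->
    sigma n.+1 j (delta n.+1 i f) = delta n i.-1 (sigma n j f);
  cocyc_taudelta : forall n i (f : C n), (1 <= i <= n.+1)%N ->
    tau n.+1 (delta n i f) = delta n i.-1 (tau n f);
  cocyc_taudelta0 : forall n (f : C n), tau n.+1 (delta n 0 f) = delta n n.+1 f;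
  cocyc_tausigma : forall n i (f : C n.+1), (1 <= i <= n)%N ->
    tau n (sigma n i f) = sigma n i.-1 (tau n.+1 f);
  cocyc_tausigma0 : forall n (f : C n.+1),
    tau n (sigma n 0 f) = sigma n n (tau n.+1 (tau n.+1 f));
  cocyc_tau_iter : forall n (f : C n), iter n.+1 (tau n) f = f
}.

Record is_cyclic (k : fieldType) (C : nat -> lmodType k)
    (d : forall n, nat -> {linear C n.+1 -> C n})
    (s : forall n, nat -> {linear C n -> C n.+1})
    (t : forall n, {linear C n -> C n}) : Prop := IsCyclic {
  cyc_dd : forall n i j (x : C n.+2), (i < j <= n.+2)%N ->
    d n i (d n.+1 j x) = d n j.-1 (d n.+1 i x);
  cyc_ss : forall n i j (x : C n), (i <= j <= n)%N ->
    s n.+1 i (s n j x) = s n.+1 j.+1 (s n i x);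
  cyc_ds_lt : forall n i j (x : C n.+1), (i < j <= n.+1)%N ->
    d n.+1 i (s n.+1 j x) = s n j.-1 (d n i x);
  cyc_ds_eq : forall n j (x : C n), (j <= n)%N -> d n j (s n j x) = x;
  cyc_ds_eqS : forall n j (x : C n), (j <= n)%N -> d n j.+1 (s n j x) = x;
  cyc_ds_gt : forall n i j (x : C n.+1), (j.+1 < i <= n.+2)%N ->
    d n.+1 i (s n.+1 j x) = s n j (d n i.-1 x);
  cyc_dt : forall n i (x : C n.+1), (1 <= i <= n.+1)%N ->
    d n i (t n.+1 x) = t n (d n i.-1 x);
  cyc_dt0 : forall n (x : C n.+1), d n 0 (t n.+1 x) = d n n.+1 x;
  cyc_st : forall n i (x : C n), (1 <= i <= n)%N ->
    s n i (t n x) = t n.+1 (s n i.-1 x);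
  cyc_st0 : forall n (x : C n), s n 0 (t n x) = t n.+1 (t n.+1 (s n n x));
  cyc_t_iter : forall n (x : C n), iter n.+1 (t n) x = x
}.

(* Main.v *)
(** A linear map [e : X -> Y ⊗ H] between right comodules is an arrow [X -> Y] in
    the Kleisli category of the monad [- ⊗ H].  Writing [e x = y ⊗ h], it induces
    [f |-> (x |-> f(y) h)] on linear maps and [x ⊗ m |-> y ⊗ h m] on tensors, and
    the operators of both parts of the theorem arise from the same arrows: the
    inner faces and the degeneracies (with trivial [H]-component), the rotation
    [a_0 ⊗ ... ⊗ a_n |-> (a_n^(0) ⊗ a_0 ⊗ ... ⊗ a_(n-1)) ⊗ a_n^(1)], and the last
    face, which is the rotation followed by the face 0.  Hence the cyclic
    identities are proved once, for arrows.  These arrows all satisfy the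
    compatibility [twisted] with the coactions, which combined with the
    anti-Yetter-Drinfeld condition makes the induced operators preserve
    colinearity and the cotensor product.  Finally the (n+1)-st power of the
    rotation is the diagonal coaction, which acts as the identity by stability. *)

Require Import Defs.
From HB Require Import structures.
From mathcomp Require Import all_boot all_order all_algebra.
From mathcomp Require Import boolp zify.

Set Implicit Arguments.
Unset Strict Implicit.
Unset Printing Implicit Defensive.

Import GRing.Theory.
Local Open Scope ring_scope.

(** * Closure properties of linear maps, and a tactic proving linearity *)

Section Linearity.
Variable k : fieldType.
Implicit Types U V W X : lmodType k.

(** A constant standing for [linear], so that linearity goals keep a fixed head and the tactic [lin]
    can match on the body of the function. *)
Definition lin U V (f : U -> V) : Prop := linear f.

Lemma bilinI U V W (F : U -> V -> W) :
  (forall v, lin (fun u => F u v)) -> (forall u, lin (F u)) -> bilin F.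
Proof. by []. Qed.

Lemma lin_add U V (f : U -> V) : lin f -> {morph f : x y / x + y}.
Proof. by move=> fL x y; have := fL 1 x y; rewrite !scale1r. Qed.

Lemma lin0 U V (f : U -> V) : lin f -> f 0 = 0.
Proof. by move=> fL; apply: (addrI (f 0)); rewrite -(lin_add fL) !addr0. Qed.

Lemma lin_scale U V (f : U -> V) : lin f -> forall c, {morph f : x / c *: x}.
Proof. by move=> fL c x; have := fL c x 0; rewrite (lin0 fL) !addr0. Qed.

Lemma lin_sum U V (f : U -> V) I (r : seq I) (F : I -> U) : lin f ->
  f (\sum_(i <- r) F i) = \sum_(i <- r) f (F i).
Proof. by move=> fL; apply: (big_morph f (lin_add fL) (lin0 fL)). Qed.

Lemma lin_id U : lin (fun x : U => x). Proof. by []. Qed.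

Lemma lin_comp U V W (f : V -> W) (E : U -> V) :
  lin f -> lin E -> lin (fun x => f (E x)).
Proof. by move=> fL EL c x y; rewrite EL fL. Qed.

Lemma lin_linear U V W (f : {linear V -> W}) (E : U -> V) :
  lin E -> lin (fun x => f (E x)).
Proof. by apply: lin_comp => c x y; rewrite linearP. Qed.

Lemma lin_purel U V W (v : W) (E : U -> V) : lin E -> lin (fun x => E x ⊗ v).
Proof. by move=> EL c x y; rewrite EL pureDl pureZl. Qed.

Lemma lin_purer U V W (v : W) (E : U -> V) : lin E -> lin (fun x => v ⊗ E x).
Proof. by move=> EL c x y; rewrite EL pureDr pureZr. Qed.

Lemma lin_mull U (R : algType k) (h : R) (E : U -> R) :
  lin E -> lin (fun x => E x * h).
Proof. by move=> EL c x y; rewrite EL mulrDl scalerAl. Qed.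

Lemma lin_mulr U (R : algType k) (h : R) (E : U -> R) :
  lin E -> lin (fun x => h * E x).
Proof. by move=> EL c x y; rewrite EL mulrDr scalerAr. Qed.

Lemma lin_scaler U V (b : k) (E : U -> V) : lin E -> lin (fun x => b *: E x).
Proof. by move=> EL c x y; rewrite EL scalerDr !scalerA mulrC. Qed.

Lemma lin_counit U V (H : hopfAlgebra k) (v : V) (E : U -> H) :
  lin E -> lin (fun x => counit H (E x) *: v).
Proof. by move=> EL c x y; rewrite EL linearP scalerDl -scalerA. Qed.

Lemma lin_amull U (A : algebra k) (b : A) (E : U -> A) :
  lin E -> lin (fun x => amul (E x) b).
Proof. exact: (lin_comp (f := fun a : A => amul a b) ((amul_bilin A).1 b)). Qed.

Lemma lin_amulr U (A : algebra k) (b : A) (E : U -> A) :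
  lin E -> lin (fun x => amul b (E x)).
Proof. exact: (lin_comp (f := fun a : A => amul b a) ((amul_bilin A).2 b)). Qed.

Lemma lin_ractl U (H : hopfAlgebra k) (M : rmodComod H) h (E : U -> M) :
  lin E -> lin (fun x => ract (E x) h).
Proof. exact: (lin_comp (f := fun m : M => ract m h) ((ract_bilin M).1 h)). Qed.

Lemma lin_ractr U (H : hopfAlgebra k) (M : rmodComod H) (m : M) (E : U -> H) :
  lin E -> lin (fun x => ract m (E x)).
Proof. exact: (lin_comp (f := fun h : H => ract m h) ((ract_bilin M).2 m)). Qed.

Lemma lin_lactl U (H : hopfAlgebra k) (M : lmodComod H) (m : M) (E : U -> H) :
  lin E -> lin (fun x => lact (E x) m).
Proof. exact: (lin_comp (f := fun h : H => lact h m) ((lact_bilin M).1 m)). Qed.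

Lemma lin_lactr U (H : hopfAlgebra k) (M : lmodComod H) h (E : U -> M) :
  lin E -> lin (fun x => lact h (E x)).
Proof. exact: (lin_comp (f := fun m : M => lact h m) ((lact_bilin M).2 h)). Qed.

Lemma lin_tcoact U (H : hopfAlgebra k) (A : comodAlgebra H) n (E : U -> tpow A n) :
  lin E -> lin (fun x => tcoact A n (E x)).
Proof. by apply: lin_comp; exact: tcoact_linear. Qed.

Lemma lin_sw U V W X (x : tensor V W) (F : U -> V -> W -> X) :
  (forall v w, lin (fun u => F u v w)) -> lin (fun u => sweedler x (F u)).
Proof.
move=> FL c u u'; rewrite /sweedler scaler_sumr -big_split.
by apply: eq_bigr => p _; rewrite FL.
Qed.

Lemma lin_sw_arg U V W X (F : V -> W -> X) (E : U -> tensor V W) :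
  bilin F -> lin E -> lin (fun u => sweedler (E u) F).
Proof. by move=> /sweedler_linear FL; exact: (lin_comp (f := fun t => sweedler t F)). Qed.

End Linearity.

(** Extension point of the tactic [lin], redefined once the maps on tensor powers are known to be
    linear. *)
Ltac lin_hook := fail.
(** Recursion on the body of the function. For an operation of several arguments, each position of
    the variable is tried in turn; for a Sweedler sum, the variable sits either in the summand or in
    the tensor that is decomposed. *)
Ltac lin :=
  cbv beta;
  lazymatch goal with
  | |- forall _, _ => intro; lin
  | |- bilin _ => apply: bilinI; lin
  | |- GRing.linear_for _ _ => change (lin _); lin
  | |- lin (fun x => x) => exact: lin_id
  | |- lin (fun x => sweedler _ _) => first [apply: lin_sw | apply: lin_sw_arg]; lin
  | |- lin (fun x => _ ⊗ _) => first [apply: lin_purel | apply: lin_purer]; lin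
  | |- lin (fun x => _ * _) => first [apply: lin_mull | apply: lin_mulr]; lin
  | |- lin (fun x => _ *: _) => first [apply: lin_scaler | apply: lin_counit]; lin
  | |- lin (fun x => amul _ _) => first [apply: lin_amull | apply: lin_amulr]; lin
  | |- lin (fun x => ract _ _) => first [apply: lin_ractl | apply: lin_ractr]; lin
  | |- lin (fun x => lact _ _) => first [apply: lin_lactl | apply: lin_lactr]; lin
  | |- lin (fun x => tcoact _ _ _) => apply: lin_tcoact; lin
  | |- lin (fun x => GRing.Linear.sort ?f (@?E x)) => apply: (lin_linear f); lin
  | |- lin (fun x => _) =>
      first [ assumption | lin_hook
        | match goal with
          | L : lin _ |- _ => apply: (lin_comp L)
          | L : linear ?f |- _ => apply: (lin_comp (f := f) L)
          | L : forall _, lin _ |- _ => apply: (lin_comp (L _))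
          | L : forall _ _, lin _ |- _ => apply: (lin_comp (L _ _))
          | L : bilin ?f |- _ => first [ apply: (lin_comp (f := f _) (L.2 _))
               | apply: (lin_comp (f := fun z => f z _) (L.1 _))]
          end ]; lin
  | |- lin ?f => first [ assumption | change (lin (fun x => f x)); lin ]
  | |- _ => idtac
  end.

(** * Calculus of Sweedler sums *)

Section Sweedler.
Variable k : fieldType.
Implicit Types U V W X Y : lmodType k.

Lemma eq_sw U V W (x : tensor U V) (F G : U -> V -> W) :
  (forall u v, F u v = G u v) -> sweedler x F = sweedler x G.
Proof. by move=> FG; apply: eq_bigr => p _; exact: FG. Qed.

Lemma sw_lin U V W X (f : W -> X) (x : tensor U V) (F : U -> V -> W) : lin f ->
  f (sweedler x F) = sweedler x (fun u v => f (F u v)).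
Proof. by move=> fL; rewrite /sweedler (lin_sum _ _ fL). Qed.

Lemma sw_sw U V X Y W (x : tensor U V) (G : U -> V -> tensor X Y) (F : X -> Y -> W) :
  bilin F ->
  sweedler (sweedler x G) F = sweedler x (fun u v => sweedler (G u v) F).
Proof. by move=> /sweedler_linear FL; apply: (sw_lin (f := fun t => sweedler t F)). Qed.

Lemma sw_exchange U V X Y W (x : tensor U V) (y : tensor X Y)
    (F : U -> V -> X -> Y -> W) :
  sweedler x (fun u v => sweedler y (F u v)) =
  sweedler y (fun a b => sweedler x (fun u v => F u v a b)).
Proof. exact: exchange_big. Qed.

Lemma sw_tmap U V X Y W (f : U -> X) (g : V -> Y) (x : tensor U V) (F : X -> Y -> W) :
  bilin F -> sweedler (tmap f g x) F = sweedler x (fun u v => F (f u) (g v)).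
Proof. by move=> FL; rewrite sw_sw //; apply: eq_sw => u v; rewrite sweedler_pure. Qed.

Lemma sw_tassoc U V W X (x : tensor U (tensor V W)) (F : tensor U V -> W -> X) :
  bilin F -> sweedler (tassoc x) F =
  sweedler x (fun u y => sweedler y (fun v w => F (u ⊗ v) w)).
Proof.
move=> FL; rewrite sw_sw //; apply: eq_sw => u y; rewrite sw_sw //.
by apply: eq_sw => v w; rewrite sweedler_pure.
Qed.

Lemma sw_id U V (x : tensor U V) : sweedler x (fun u v => u ⊗ v) = x.
Proof.
have L : lin (fun x : tensor U V => sweedler x (fun u v => u ⊗ v)) by lin.
elim/tensor_ind: x => [|u v|x y ex ey]; first exact: lin0 L.
  by rewrite sweedler_pure //; lin.
by rewrite (lin_add L) ex ey.
Qed.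

Definition trilin U V W X (F : U -> V -> W -> X) : Prop :=
  [/\ forall v w, lin (fun u => F u v w), forall u w, lin (fun v => F u v w)
    & forall u v, lin (F u v)].

(** Two nested Sweedler sums thus evaluate a trilinear [F] on a threefold tensor. This is how the
    tensor identities in the axioms are turned below into identities valid under any trilinear
    [F]. *)
Lemma trilin_bilin U V W X (F : U -> V -> W -> X) : trilin F ->
  bilin (fun x w => sweedler x (fun u v => F u v w)).
Proof. by case=> F1 F2 F3; lin. Qed.

End Sweedler.

(** * Comodule and Hopf algebra axioms in Sweedler form; the antipode reverses products *)

Section Coassociativity.
Variables (k : fieldType) (H : hopfAlgebra k).
Implicit Types W X : lmodType k.

Lemma sw_rcoassoc X W (rho : {linear X -> tensor X H}) (F : X -> H -> H -> W) x :
  is_rcoaction rho -> trilin F ->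
  sweedler (rho x) (fun x0 x1 => sweedler (rho x0) (fun y0 y1 => F y0 y1 x1)) =
  sweedler (rho x) (fun x0 x1 => sweedler (comul H x1) (F x0)).
Proof.
move=> [/(_ x) C _] FL; have [F1 F2 F3] := FL.
have B := trilin_bilin FL.
have := congr1 (fun t => sweedler t (fun x w => sweedler x (fun u v => F u v w))) C.
rewrite /= sw_tassoc // !sw_tmap //; last by lin.
move=> <-; apply: eq_sw => x0 x1; apply: eq_sw => h1 h2.
by rewrite sweedler_pure //; lin.
Qed.

Lemma sw_rcounit X W (rho : {linear X -> tensor X H}) (f : X -> W) x :
  is_rcoaction rho -> lin f ->
  sweedler (rho x) (fun x0 x1 => counit H x1 *: f x0) = f x.
Proof.
move=> [_ /(_ x) {2}<-] fL; rewrite (sw_lin _ _ fL).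
by apply: eq_sw => x0 x1; rewrite (lin_scale fL).
Qed.

(** [H] is a right comodule over itself, so the rules for its coproduct are instances of those for
    coactions. *)
Lemma comul_rcoaction : is_rcoaction (comul H).
Proof. by split=> h; [exact: comulA | exact: counitr]. Qed.

Lemma sw_comulA W (F : H -> H -> H -> W) h : trilin F ->
  sweedler (comul H h) (fun h1 h2 => sweedler (comul H h1) (fun g1 g2 => F g1 g2 h2)) =
  sweedler (comul H h) (fun h1 h2 => sweedler (comul H h2) (F h1)).
Proof. exact: sw_rcoassoc comul_rcoaction. Qed.

Lemma sw_counitr W (f : H -> W) h : lin f ->
  sweedler (comul H h) (fun h1 h2 => counit H h2 *: f h1) = f h.
Proof. exact: sw_rcounit comul_rcoaction. Qed.

Lemma sw_counitl W (f : H -> W) h : lin f ->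
  sweedler (comul H h) (fun h1 h2 => counit H h1 *: f h2) = f h.
Proof.
move=> fL; rewrite -{2}(counitl h) (sw_lin _ _ fL).
by apply: eq_sw => h1 h2; rewrite (lin_scale fL).
Qed.

Lemma sw_comulM W (F : H -> H -> W) g h : bilin F ->
  sweedler (comul H (g * h)) F = sweedler (comul H g) (fun g1 g2 =>
    sweedler (comul H h) (fun h1 h2 => F (g1 * h1) (g2 * h2))).
Proof.
move=> FL; rewrite comulM sw_sw //; apply: eq_sw => g1 g2; rewrite sw_sw //.
by apply: eq_sw => h1 h2; rewrite sweedler_pure.
Qed.

Lemma antipode1 : antipode H 1 = 1.
Proof.
have := antipodel (1 : H); rewrite comul1 sweedler_pure; last by lin.
by rewrite mulr1 counit1 scale1r.
Qed.

(* Both sides are convolution inverses of the multiplication. *)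
Lemma antipodeM g h : antipode H (g * h) = antipode H h * antipode H g.
Proof.
pose E := sweedler (comul H g) (fun g1 g2 => sweedler (comul H g2) (fun g2 g3 =>
  sweedler (comul H h) (fun h1 h2 => sweedler (comul H h2) (fun h2 h3 =>
   antipode H (g1 * h1) * (g2 * h2) * (antipode H h3 * antipode H g3))))).
transitivity E; rewrite /E {E}.
  transitivity (sweedler (comul H g) (fun g1 g2 => sweedler (comul H h) (fun h1 h2 =>
     counit H g2 *: (counit H h2 *: antipode H (g1 * h1))))).
    transitivity (sweedler (comul H g) (fun g1 g2 => counit H g2 *: antipode H (g1 * h))).
      by rewrite sw_counitr //; lin.
    apply: eq_sw => g1 g2; rewrite -(sw_lin (f := fun x => counit H g2 *: x)); last by lin.
    by rewrite sw_counitr //; lin.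
  apply: eq_sw => g1 g2; rewrite [RHS]sw_exchange; apply: eq_sw => h1 h2.
  transitivity (sweedler (comul H g2) (fun g2 g3 => sweedler (comul H h2) (fun h2 h3 =>
     antipode H (g1 * h1) * g2 * (h2 * antipode H h3) * antipode H g3))); last first.
    by apply: eq_sw => ? ?; apply: eq_sw => ? ?; rewrite !mulrA.
  transitivity (sweedler (comul H g2) (fun g2 g3 =>
     antipode H (g1 * h1) * g2 * (counit H h2)%:A * antipode H g3)).
    transitivity (sweedler (comul H g2) (fun g2 g3 =>
     antipode H (g1 * h1) * (g2 * antipode H g3) * (counit H h2)%:A)).
      rewrite -(sw_lin (f := fun x => antipode H (g1 * h1) * x * (counit H h2)%:A)); last by lin.
      by rewrite antipoder !mulr_algr scalerA mulrC scalerA.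
    by apply: eq_sw => ? ?; rewrite !mulr_algr -scalerAl !mulrA.
   apply: eq_sw => a b.
  rewrite -antipoder.
  by rewrite (sw_lin (f := fun x => antipode H (g1 * h1) * a * x * antipode H b)) //; lin.
transitivity (sweedler (comul H g) (fun g1 g2 => sweedler (comul H g1) (fun g1 g3 =>
  sweedler (comul H h) (fun h1 h2 => sweedler (comul H h1) (fun h1 h3 =>
   antipode H (g1 * h1) * (g3 * h3) * (antipode H h2 * antipode H g2)))))).
  rewrite sw_comulA; last by split; lin.
  apply: eq_sw => ? ?; apply: eq_sw => ? ?.
  by rewrite sw_comulA; last by split; lin.
transitivity (sweedler (comul H g) (fun g1 g2 => sweedler (comul H h) (fun h1 h2 =>
    counit H g1 *: (counit H h1 *: (antipode H h2 * antipode H g2))))).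
  apply: eq_sw => g1 g2; rewrite sw_exchange; apply: eq_sw => h1 h2.
  rewrite -(sw_comulM (F := fun a b => antipode H a * b * _)); last by lin.
  rewrite -(sw_lin (f := fun x => x * _)); last by lin.
  by rewrite antipodel counitM mulr_algl scalerA.
transitivity (sweedler (comul H g) (fun g1 g2 => counit H g1 *: (antipode H h * antipode H g2))).
  apply: eq_sw => g1 g2; rewrite -(sw_lin (f := fun x => counit H g1 *: x)); last by lin.
  by rewrite sw_counitl //; lin.
by rewrite sw_counitl //; lin.
Qed.

End Coassociativity.

(** * The inverse of the antipode *)

Section InverseAntipode.
Variables (k : fieldType) (H : hopfAlgebra k) (Sinv : H -> H).
Hypotheses (antipodeK : cancel (antipode H) Sinv)
  (antipodeVK : cancel Sinv (antipode H)).

Lemma Sinv_lin : lin Sinv.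
Proof.
by move=> c x y; apply: (can_inj antipodeK); rewrite linearP !antipodeVK.
Qed.

(** The inverse antipode satisfies the antipode axioms for the opposite coproduct: applying the
    injective map [antipode H], which reverses products, gives back [antipodel] here and [antipoder]
    in [Sinvr]. *)
Lemma Sinvl h : sweedler (comul H h) (fun h1 h2 => Sinv h2 * h1) = (counit H h)%:A.
Proof.
have SL := Sinv_lin.
apply: (can_inj antipodeK); rewrite linearZ /= antipode1.
rewrite (sw_lin (f := antipode H)); last by lin.
by apply: etrans (antipodel h); apply: eq_sw => a b; rewrite antipodeM antipodeVK.
Qed.

Lemma Sinvr h : sweedler (comul H h) (fun h1 h2 => h2 * Sinv h1) = (counit H h)%:A.
Proof.
have SL := Sinv_lin.
apply: (can_inj antipodeK); rewrite linearZ /= antipode1.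
rewrite (sw_lin (f := antipode H)); last by lin.
by apply: etrans (antipoder h); apply: eq_sw => a b; rewrite antipodeM antipodeVK.
Qed.

End InverseAntipode.

(** * Twisted arrows and their Kleisli composition *)

Section Twisted.
Variables (k : fieldType) (H : hopfAlgebra k).
Implicit Types W X Y Z : lmodType k.

(* With [e x = y ⊗ h] and [e x0 = y' ⊗ h'], this reads
   [y0 ⊗ h1 ⊗ y1 h2 = y' ⊗ h'2 ⊗ h'1 x1]. *)
Definition twisted X Y (rhoX : X -> tensor X H) (rhoY : Y -> tensor Y H)
    (e : X -> tensor Y H) : Prop :=
  lin e /\ forall x,
    sweedler (e x) (fun y h => sweedler (rhoY y) (fun y0 y1 =>
      sweedler (comul H h) (fun h1 h2 => (y0 ⊗ h1) ⊗ (y1 * h2)))) =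
    sweedler (rhoX x) (fun x0 x1 => sweedler (e x0) (fun y h =>
      sweedler (comul H h) (fun h1 h2 => (y ⊗ h2) ⊗ (h1 * x1)))).

(** The working form of [twisted]: its defining identity in the threefold tensor product, evaluated
    at a trilinear [F]. *)
Lemma twisted_app X Y W (rhoX : X -> tensor X H) (rhoY : Y -> tensor Y H)
    (e : X -> tensor Y H) (F : Y -> H -> H -> W) x :
  twisted rhoX rhoY e -> trilin F ->
  sweedler (e x) (fun y h => sweedler (rhoY y) (fun y0 y1 =>
    sweedler (comul H h) (fun h1 h2 => F y0 h1 (y1 * h2)))) =
  sweedler (rhoX x) (fun x0 x1 => sweedler (e x0) (fun y h =>
    sweedler (comul H h) (fun h1 h2 => F y h2 (h1 * x1)))).
Proof.
move=> [_ /(_ x) eT] FL; have [F1 F2 F3] := FL.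
have B := trilin_bilin FL.
have L : lin (fun t => sweedler t (fun x w => sweedler x (fun u v => F u v w))).
  by lin.
have Lp y h l : F y h l =
    sweedler (y ⊗ h ⊗ l) (fun x w => sweedler x (fun u v => F u v w)).
  by rewrite sweedler_pure // sweedler_pure //; lin.
have := congr1 (fun t => sweedler t (fun x w => sweedler x (fun u v => F u v w))) eT.
rewrite /= !(sw_lin _ _ L) => eF.
etransitivity; last (etransitivity; first exact: eF).
- apply: eq_sw => y h; rewrite (sw_lin _ _ L); apply: eq_sw => y0 y1.
  by rewrite (sw_lin _ _ L); apply: eq_sw => h1 h2.
- apply: eq_sw => y h; rewrite (sw_lin _ _ L); apply: eq_sw => y0 y1.
  by rewrite (sw_lin _ _ L); apply: eq_sw => h1 h2.
Qed.

(** The [H]-component of the outer arrow multiplies on the left. With [e x = y ⊗ h] and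
    [g y = z ⊗ l], this order fits both f(z) l h for a right module and z ⊗ l h m for a left
    module. *)
Definition kcomp X Y Z (g : Y -> tensor Z H) (e : X -> tensor Y H) (x : X) :
    tensor Z H :=
  sweedler (e x) (fun y h => sweedler (g y) (fun z l => z ⊗ (l * h))).

Lemma kcomp_lin X Y Z (g : Y -> tensor Z H) (e : X -> tensor Y H) :
  lin g -> lin e -> lin (kcomp g e).
Proof. by move=> gL eL; rewrite /kcomp; lin. Qed.

Lemma sw_kcomp W X Y Z (g : Y -> tensor Z H) (e : X -> tensor Y H)
    (F : Z -> H -> W) x : lin g -> bilin F ->
  sweedler (kcomp g e x) F =
  sweedler (e x) (fun y h => sweedler (g y) (fun z l => F z (l * h))).
Proof.
move=> gL FL; rewrite sw_sw //; apply: eq_sw => y h; rewrite sw_sw //.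
by apply: eq_sw => z l; rewrite sweedler_pure.
Qed.

Lemma kcompA X Y Z V (f : Z -> tensor V H) (g : Y -> tensor Z H)
    (e : X -> tensor Y H) x : lin f -> lin g ->
  kcomp f (kcomp g e) x = kcomp (kcomp f g) e x.
Proof.
move=> fL gL; rewrite {1}/kcomp sw_kcomp //; last by lin.
apply: eq_sw => y h; rewrite sw_kcomp //; last by lin.
by apply: eq_sw => z l; apply: eq_sw => v j; rewrite mulrA.
Qed.

(** With [e x = y ⊗ h] and [g y = z ⊗ l], multiplicativity of the coproduct splits that of [l * h].
    The twist of [g] then trades the coaction of z for that of y, and the twist of [e] trades the
    coaction of y for that of x. *)
Lemma kcomp_twisted X Y Z (rhoX : {linear X -> tensor X H})
   (rhoY : {linear Y -> tensor Y H}) (rhoZ : {linear Z -> tensor Z H}) g e :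
  twisted rhoY rhoZ g -> twisted rhoX rhoY e -> twisted rhoX rhoZ (kcomp g e).
Proof.
move=> gT eT; have [gL _] := gT; have [eL _] := eT.
split=> [|x]; first exact: kcomp_lin.
rewrite sw_kcomp //; last by lin.
transitivity (sweedler (e x) (fun y h => sweedler (rhoY y) (fun y0 y1 =>
  sweedler (comul H h) (fun h1 h2 => sweedler (g y0) (fun z l =>
    sweedler (comul H l) (fun l1 l2 => z ⊗ (l2 * h1) ⊗ (l1 * (y1 * h2)))))))).
  apply: eq_sw => y h.
  transitivity (sweedler (comul H h) (fun h1 h2 => sweedler (g y) (fun z l =>
    sweedler (rhoZ z) (fun z0 z1 => sweedler (comul H l) (fun l1 l2 =>
     z0 ⊗ (l1 * h1) ⊗ (z1 * l2 * h2)))))).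
    rewrite [RHS]sw_exchange; apply: eq_sw => z l.
    rewrite [RHS]sw_exchange; apply: eq_sw => z0 z1.
    rewrite sw_comulM; last by lin.
    rewrite [LHS]sw_exchange; apply: eq_sw => h1 h2; apply: eq_sw => l1 l2.
    by rewrite mulrA.
  rewrite [RHS]sw_exchange; apply: eq_sw => h1 h2.
  rewrite (twisted_app (F := fun z l j => z ⊗ (l * h1) ⊗ (j * h2)) _ gT); last by split; lin.
  apply: eq_sw => y0 y1; apply: eq_sw => z l; apply: eq_sw => l1 l2.
  by rewrite mulrA.
rewrite (twisted_app (F := fun y h j => sweedler (g y) (fun z l => sweedler (comul H l) (fun l1 l2 =>
  z ⊗ (l2 * h) ⊗ (l1 * j)))) _ eT); last by split; lin.
apply: eq_sw => x0 x1; rewrite sw_kcomp //; last by lin.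
apply: eq_sw => y h; rewrite sw_exchange; apply: eq_sw => z l.
rewrite sw_comulM; last by lin.
rewrite [LHS]sw_exchange; apply: eq_sw => l1 l2; apply: eq_sw => h1 h2.
by rewrite mulrA.
Qed.

(** A colinear map is a twisted arrow because its [H]-component 1 is grouplike. *)
Lemma kpure_twisted X Y (rhoX : {linear X -> tensor X H})
   (rhoY : {linear Y -> tensor Y H}) (f : X -> Y) :
  lin f -> (forall x, rhoY (f x) = tmap f id (rhoX x)) ->
  twisted rhoX rhoY (fun x => f x ⊗ 1).
Proof.
move=> fL fC; split=> [|x]; first by lin.
rewrite sweedler_pure; last by lin.
rewrite fC sw_tmap; last by lin.
apply: eq_sw => x0 x1; rewrite sweedler_pure; last by lin.
rewrite comul1 !sweedler_pure; first (by rewrite mulr1 mul1r); by lin.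
Qed.

(** * Operators induced by arrows on colinear maps and on cotensor products *)

Definition pull_fun X Y (M : rmodComod H) (e : X -> tensor Y H) (f : Y -> M) (x : X) : M :=
  sweedler (e x) (fun y h => ract (f y) h).

Definition push_fun X Y (M : lmodComod H) (e : X -> tensor Y H) (z : tensor X M) :
    tensor Y M :=
  sweedler z (fun x m => sweedler (e x) (fun y h => y ⊗ lact h m)).

Lemma pull_fun_lin X Y (M : rmodComod H) (e : X -> tensor Y H) (f : Y -> M) :
  lin e -> lin f -> lin (pull_fun e f).
Proof. by move=> eL fL; rewrite /pull_fun; lin. Qed.

Lemma push_fun_lin X Y (M : lmodComod H) (e : X -> tensor Y H) :
  lin e -> lin (push_fun (M := M) e).
Proof. by move=> eL; rewrite /push_fun; lin. Qed.

Lemma pull_kcomp X Y Z (M : rmodComod H) (g : Y -> tensor Z H)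
    (e : X -> tensor Y H) (f : Z -> M) x : lin f -> lin g ->
  pull_fun e (pull_fun g f) x = pull_fun (kcomp g e) f x.
Proof.
move=> fL gL; rewrite /pull_fun sw_kcomp //; last by lin.
apply: eq_sw => y h; rewrite (sw_lin (f := fun m => ract m h)); last by lin.
by apply: eq_sw => z l; rewrite ractM.
Qed.

Lemma push_kcomp X Y Z (M : lmodComod H) (g : Y -> tensor Z H)
    (e : X -> tensor Y H) (z : tensor X M) : lin g ->
  push_fun g (push_fun e z) = push_fun (kcomp g e) z.
Proof.
move=> gL; rewrite {1}/push_fun sw_sw; last by lin.
apply: eq_sw => x m; rewrite sw_sw; last by lin.
rewrite sw_kcomp //; last by lin.
apply: eq_sw => y h; rewrite sweedler_pure; last by lin.
by apply: eq_sw => w l; rewrite lactM.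
Qed.

Lemma cotensor_app W X Y (rho : {linear X -> tensor X H}) (la : {linear Y -> tensor H Y})
    (G : X -> H -> Y -> W) z : z \in cotensor_pred rho la -> trilin G ->
  sweedler z (fun x m => sweedler (rho x) (fun x0 x1 => G x0 x1 m)) =
  sweedler z (fun x m => sweedler (la m) (G x)).
Proof.
move=> /eqP zC GL; have [G1 G2 G3] := GL.
have B := trilin_bilin GL.
have := congr1 (fun t => sweedler t (fun x w => sweedler x (fun u v => G u v w))) zC.
rewrite /= sw_tassoc // !sw_tmap //; last by lin.
move=> ->; apply: eq_sw => x0 x1; apply: eq_sw => h1 h2.
by rewrite sweedler_pure //; lin.
Qed.

Section InverseAntipodeTwist.
Variable Sinv : H -> H.
Hypotheses (antipodeK : cancel (antipode H) Sinv)
  (antipodeVK : cancel Sinv (antipode H)).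

Let SL : lin Sinv := Sinv_lin antipodeK antipodeVK.

(** With [e x = y ⊗ h], the anti-Yetter-Drinfeld condition and colinearity of [f] give f(y0) h2 ⊗
    Sinv(h1) y1 h3 for the coaction of f(y) h. The twist replaces y1 times the last leg of h by the
    first leg of h times x1. The coefficient becomes Sinv(h2) h1 x1, acting leg h3, and [Sinvl]
    cancels the first two legs, leaving f(y) h ⊗ x1. *)
Lemma pull_colinear X Y (M : rmodComod H) (rhoX : {linear X -> tensor X H})
   (rhoY : {linear Y -> tensor Y H}) e (f : Y -> M) :
  is_rAYD Sinv M -> twisted rhoX rhoY e -> f \in colinear rhoY (rcoact M) ->
  pull_fun e f \in colinear rhoX (rcoact M).
Proof.
move=> MA eT /asboolP[fL fC]; have [eL _] := eT; apply/asboolP.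
split; first by apply: pull_fun_lin.
move=> x; rewrite [LHS](sw_lin (f := rcoact M)); last by lin.
transitivity (sweedler (e x) (fun y h => sweedler (rhoY y) (fun y0 y1 =>
  sweedler (comul H h) (fun h1 h2 =>
    sweedler (comul H h1) (fun g1 g2 => ract (f y0) g2 ⊗ (Sinv g1 * (y1 * h2))))))).
  apply: eq_sw => y h; rewrite MA fC sw_tmap; last by rewrite /sweedler3; lin.
  apply: eq_sw => y0 y1; rewrite sw_comulA; last by split; lin.
  by apply: eq_sw => h1 h'; apply: eq_sw => h2 h3; rewrite mulrA.
rewrite (twisted_app (F := fun y h l => sweedler (comul H h) (fun h1 h2 =>
  ract (f y) h2 ⊗ (Sinv h1 * l))) _ eT); last by split; lin.
apply: eq_sw => x0 x1; rewrite /pull_fun.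
rewrite [RHS](sw_lin (f := fun y => y ⊗ x1)); last by lin.
apply: eq_sw => y h.
rewrite -sw_comulA; last by split; lin.
rewrite -(sw_counitl (f := fun l => ract (f y) l ⊗ x1)); last by lin.
apply: eq_sw => h1 h2.
transitivity (ract (f y) h2 ⊗ (sweedler (comul H h1) (fun h1 h2 => Sinv h2 * h1) * x1)).
  rewrite (sw_lin (f := fun l => ract (f y) h2 ⊗ (l * x1))); last by lin.
  by apply: eq_sw => ? ?; rewrite mulrA.
by rewrite Sinvl // mulr_algl pureZr.
Qed.

(** Dual to the colinear case. The anti-Yetter-Drinfeld condition produces h1 m1 Sinv(h3), the
    cotensor condition replaces m1 by x1, and the twist read backwards turns h1 x1 into y1 times the
    last leg of h. What remains is y1 h3 Sinv(h2), which [Sinvr] reduces to y1. *)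
Lemma push_cotensor X Y (M : lmodComod H) (rhoX : {linear X -> tensor X H})
   (rhoY : {linear Y -> tensor Y H}) e (z : tensor X M) :
  is_lAYD Sinv M -> twisted rhoX rhoY e -> z \in cotensor_pred rhoX (lcoact M) ->
  push_fun e z \in cotensor_pred rhoY (lcoact M).
Proof.
move=> MA eT zC; have [eL _] := eT; apply/eqP.
rewrite /tmap !sw_sw; try lin.
rewrite [RHS](sw_lin (f := @tassoc k Y H M)); last exact: tassoc_linear.
(* The right-hand side after the anti-Yetter-Drinfeld condition, with the coefficient [l] kept as an
   argument, so that [cotensor_app] can exchange the coaction of m for that of x. *)
pose G x l (m : M) := sweedler (e x) (fun y h => sweedler3 h (fun h1 h2 h3 =>
  y ⊗ (h1 * l * Sinv h3) ⊗ lact h2 m)).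
have GL : trilin G by rewrite /G /sweedler3; split; lin.
transitivity (sweedler z (fun x m => sweedler (lcoact M m) (fun m1 m0 => G x m1 m0))); last first.
  apply: eq_sw => x m.
  rewrite sw_sw; last by lin.
  rewrite [RHS](sw_lin (f := @tassoc k Y H M)); last exact: tassoc_linear.
  rewrite sw_exchange; apply: eq_sw => y h.
  rewrite sweedler_pure; last by lin.
  rewrite /tassoc sweedler_pure; last by lin.
  rewrite MA sw_sw; last by lin.
  apply: eq_sw => m1 m0; rewrite /sweedler3 sw_sw; last by lin.
  apply: eq_sw => h1 h'; rewrite sw_sw; last by lin.
  by apply: eq_sw => h2 h3; rewrite sweedler_pure //; lin.
rewrite -(cotensor_app zC GL); apply: eq_sw => x m; rewrite /G.
transitivity (sweedler (rhoX x) (fun x0 x1 => sweedler (e x0) (fun y h =>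
  sweedler (comul H h) (fun h1 h2 => sweedler (comul H h2) (fun g1 g2 =>
    y ⊗ (h1 * x1 * Sinv g2) ⊗ lact g1 m))))); last by [].
rewrite -(twisted_app (F := fun y h l => sweedler (comul H h) (fun g1 g2 =>
  y ⊗ (l * Sinv g2) ⊗ lact g1 m)) _ eT); last by split; lin.
rewrite sw_sw; last by lin.
apply: eq_sw => y h; rewrite sweedler_pure; last by lin.
rewrite -{1}(sw_id (rhoY y)) (sw_lin (f := fun t => t ⊗ _)); last by lin.
apply: eq_sw => y0 y1; rewrite sw_comulA; last by split; lin.
rewrite -(sw_counitr (f := fun l => y0 ⊗ y1 ⊗ lact l m)); last by lin.
apply: eq_sw => h1 h2.
transitivity (y0 ⊗ (y1 * sweedler (comul H h2) (fun h2 h3 => h3 * Sinv h2)) ⊗ lact h1 m).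
  by rewrite Sinvr // mulr_algr pureZr pureZl.
rewrite (sw_lin (f := fun l => y0 ⊗ (y1 * l) ⊗ lact h1 m)); last by lin.
by apply: eq_sw => ? ?; rewrite mulrA.
Qed.
End InverseAntipodeTwist.

End Twisted.

(** * Inserting, multiplying and rotating factors of a tensor power *)

Section TensorPowerMaps.
Variables (k : fieldType) (H : hopfAlgebra k) (A : comodAlgebra H).

(** Since [tpow] is bracketed to the left, a new first factor has to be carried down to the
    innermost bracket. *)
Fixpoint tcons (n : nat) (b : A) : tpow A n -> tpow A n.+1 :=
  match n return tpow A n -> tpow A n.+1 with
  | 0 => fun a => b ⊗ a
  | n'.+1 => fun x => sweedler x (fun y a => tcons b y ⊗ a)
  end.

(** The map is total in [i]: an index above [n] multiplies the last two factors, as [n] does.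
    Likewise [tins] appends 1 at the end for every index from [n] on. *)
Fixpoint tmerge (i n : nat) : tpow A n.+1 -> tpow A n :=
  match n return tpow A n.+1 -> tpow A n with
  | 0 => fun x => sweedler x amul
  | n'.+1 => fun x => sweedler x (fun y b =>
      if (i <= n')%N then tmerge i y ⊗ b
      else sweedler y (fun z a => z ⊗ amul a b))
  end.

Fixpoint tins (i n : nat) : tpow A n -> tpow A n.+1 :=
  match n return tpow A n -> tpow A n.+1 with
  | 0 => fun a => a ⊗ aone
  | n'.+1 => fun x =>
      if (i <= n')%N then sweedler x (fun y b => tins i y ⊗ b) else x ⊗ aone
  end.

Definition trot (n : nat) : tpow A n -> tensor (tpow A n) H :=
  match n return tpow A n -> tensor (tpow A n) H with
  | 0 => coact A
  | n'.+1 => fun x => sweedler x (fun y b =>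
      sweedler (coact A b) (fun b0 b1 => tcons b0 y ⊗ b1))
  end.

Arguments tcons {n} b x.
Arguments tmerge i {n} x.
Arguments tins i {n} x.
Arguments trot {n} x.

Lemma tcons_bilin n : bilin (tcons (n := n)).
Proof. by elim: n => [|n IHn]; apply: bilinI => /=; lin. Qed.

Lemma tmerge_lin i n : lin (tmerge i (n := n)).
Proof.
elim: n => [|n IHn] /=; first by apply: lin_sw_arg; [exact: amul_bilin | lin].
apply: lin_sw_arg; last by lin.
by case: leqP => _; lin.
Qed.

Lemma tins_lin i n : lin (tins i (n := n)).
Proof. by elim: n => [|n IHn] /=; [|case: leqP => _]; lin. Qed.

Lemma trot_lin n : lin (trot (n := n)).
Proof. by case: n => [|n] /=; [|have := tcons_bilin n]; lin. Qed.

(** Through this reduction to pure tensors, an identity between maps on tensor powers becomes a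
    comparison of families, index by index. *)
Lemma tpow_ext (W : lmodType k) n (f g : tpow A n -> W) : lin f -> lin g ->
  (forall a, f (tpure n a) = g (tpure n a)) -> f =1 g.
Proof.
move=> fL gL fg x; have [s ->] := tpow_decomp x.
by rewrite !lin_sum //; apply: eq_bigr => a _; exact: fg.
Qed.

Lemma tensor_ext (U V W : lmodType k) (f g : tensor U V -> W) :
  lin f -> lin g -> (forall u v, f (u ⊗ v) = g (u ⊗ v)) -> f =1 g.
Proof.
move=> fL gL fg x; have [s ->] := tensor_decomp x.
by rewrite !lin_sum //; apply: eq_bigr => p _; exact: fg.
Qed.

Lemma tpowS_ext (W : lmodType k) n (f g : tpow A n.+1 -> W) :
  lin f -> lin g ->
  (forall (y : tpow A n) b, f (y ⊗ b) = g (y ⊗ b)) -> f =1 g.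
Proof. exact: tensor_ext. Qed.

Lemma tconsE n b (y : tpow A n) a :
  tcons b (y ⊗ a : tpow A n.+1) = tcons b y ⊗ a.
Proof. by have := tcons_bilin n => ?; rewrite [LHS]sweedler_pure //; lin. Qed.

Lemma tmerge0 i (a b : A) : tmerge i (a ⊗ b : tpow A 1) = amul a b.
Proof. by rewrite [LHS]sweedler_pure //; exact: amul_bilin. Qed.

Lemma tmergeE n i (y : tpow A n.+1) b : (i <= n)%N ->
  tmerge i (y ⊗ b : tpow A n.+2) = tmerge i y ⊗ b.
Proof.
move=> le_in; rewrite /tmerge -/tmerge le_in.
have L : lin (tmerge i (n := n)) by exact: tmerge_lin.
by rewrite sweedler_pure //; lin.
Qed.

Lemma tmerge_last n (y : tpow A n) a b :
  tmerge n.+1 ((y ⊗ a : tpow A n.+1) ⊗ b : tpow A n.+2) = y ⊗ amul a b.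
Proof.
rewrite /tmerge ltnn -/tmerge.
by rewrite sweedler_pure; first rewrite sweedler_pure; by [|lin].
Qed.

Lemma tinsE n i (y : tpow A n) b : (i <= n)%N ->
  tins i (y ⊗ b : tpow A n.+1) = tins i y ⊗ b.
Proof.
move=> le_in; rewrite /tins -/tins le_in.
have L : lin (tins i (n := n)) by exact: tins_lin.
by rewrite sweedler_pure //; lin.
Qed.

Lemma tins_last n i (y : tpow A n) : (n <= i)%N -> tins i y = y ⊗ aone.
Proof. by case: n y => [|n] y // lt_ni; rewrite /tins leqNgt lt_ni. Qed.

Lemma trotE n (y : tpow A n) b : trot (y ⊗ b : tpow A n.+1) =
  sweedler (coact A b) (fun b0 b1 => tcons b0 y ⊗ b1).
Proof. by have := tcons_bilin n => ?; rewrite [LHS]sweedler_pure //; lin. Qed.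

Lemma tcoactE n (y : tpow A n) b : tcoact A n.+1 (y ⊗ b) =
  sweedler (tcoact A n y) (fun y0 y1 => sweedler (coact A b) (fun b0 b1 =>
    (y0 ⊗ b0) ⊗ (y1 * b1))).
Proof.
rewrite [LHS]sweedler_pure //; apply: tcoact_bilin; exact: tcoact_linear.
Qed.

Lemma tpureS n (a : nat -> A) : tpure n.+1 a = tpure n a ⊗ a n.+1.
Proof. by []. Qed.

Lemma tcons_tpure n b (a : nat -> A) : tcons b (tpure n a) = tpure n.+1 (fcons b a).
Proof. by elim: n => [|n IHn] //; rewrite !tpureS tconsE IHn. Qed.

Lemma tpure_fcons_lin n (a : nat -> A) : lin (fun b => tpure n (fcons b a)).
Proof.
case: n => [|n]; first exact: lin_id.
by move=> c x y; rewrite -!tcons_tpure; apply: (tcons_bilin n).1.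
Qed.

End TensorPowerMaps.

Arguments tcons {k H A n} b x.
Arguments tmerge {k H A} i {n} x.
Arguments tins {k H A} i {n} x.
Arguments trot {k H A n} x.

Ltac lin_hook ::=
  match goal with
  | |- lin (fun x => tcons _ _) => first
      [ apply: (lin_comp (f := fun b => tcons b _)); first exact: (tcons_bilin _ _).1
      | apply: (lin_comp (f := tcons _)); first exact: (tcons_bilin _ _).2 ]
  | |- lin (fun x => tmerge _ _) =>
      apply: (lin_comp (f := tmerge _)); first exact: tmerge_lin
  | |- lin (fun x => tins _ _) =>
      apply: (lin_comp (f := tins _)); first exact: tins_lin
  | |- lin (fun x => trot _) => apply: (lin_comp (f := trot)); first exact: trot_lin
  | |- lin (fun x => tpure _ (fcons _ _)) =>
      apply: (lin_comp (f := fun b => tpure _ (fcons b _))); first exact: tpure_fcons_lin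
  end.

(** * Values on pure tensors, and compatibility with the diagonal coaction *)

Section Families.
Variables (k : fieldType) (H : hopfAlgebra k) (A : comodAlgebra H).
Implicit Types a : nat -> A.

Lemma tmerge_tpure n i a : (i <= n)%N ->
  tmerge i (tpure n.+1 a) = tpure n (fmerge i a).
Proof.
elim: n => [|n IHn] lein; first by case: i lein => // _; rewrite tpureS tmerge0.
rewrite !tpureS; case: (leqP i n) => [le_in|lt_ni].
  rewrite tmergeE // -tpureS IHn //; congr (_ ⊗ _).
  by rewrite /fmerge ltnNge leqW //= gtn_eqF.
have -> : i = n.+1 by apply/eqP; rewrite eqn_leq lein.
rewrite tmerge_last; congr (_ ⊗ _); last by rewrite /fmerge ltnn eqxx.
by apply: tpure_eq => j lejn; rewrite /fmerge ltnS lejn.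
Qed.

Lemma tins_tpure n i a : (i <= n)%N ->
  tins i (tpure n a) = tpure n.+1 (finsert1 i a).
Proof.
case: (ltngtP i n) => // [lt_in|->] _; last first.
  rewrite tins_last // tpureS; congr (_ ⊗ _); last by rewrite /finsert1 ltnn eqxx.
  by apply: tpure_eq => j lejn; rewrite /finsert1 lejn.
elim: n lt_in => // n IHn; rewrite ltnS => le_in.
rewrite tpureS tinsE // [RHS]tpureS; congr (_ ⊗ _); last first.
  by rewrite /finsert1 ltnNge leqW //= gtn_eqF.
move: le_in; rewrite leq_eqVlt => /predU1P[->|/IHn //].
rewrite tins_last // tpureS; congr (_ ⊗ _); last by rewrite /finsert1 ltnn eqxx.
by apply: tpure_eq => j lejn; rewrite /finsert1 lejn.
Qed.

Lemma trot_tpure n a : trot (tpure n a) =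
  sweedler (coact A (a n)) (fun b h => tpure n (fcons b a) ⊗ h).
Proof.
case: n => [|n]; first by rewrite sw_id.
by rewrite tpureS trotE; apply: eq_sw => b h; rewrite tcons_tpure.
Qed.

(** The recursion of [tcoact] splits off the last factor; the rotation needs the splitting at the
    first one. *)
Lemma tcoact_tcons n b (x : tpow A n) : tcoact A n.+1 (tcons b x) =
  sweedler (coact A b) (fun b0 b1 => sweedler (tcoact A n x) (fun x0 x1 =>
    tcons b0 x0 ⊗ (b1 * x1))).
Proof.
elim: n x => [|n IHn]; first by move=> x; rewrite [tcons b x]/(b ⊗ x) tcoactE.
apply: tpowS_ext => [||y a]; try lin.
rewrite tconsE !tcoactE IHn sw_sw; last by lin.
apply: eq_sw => b0 b1; rewrite !sw_sw; try lin.
apply: eq_sw => y0 y1; rewrite sweedler_pure; last by lin.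
rewrite sw_sw; last by lin.
apply: eq_sw => a0 a1; rewrite sweedler_pure; last by lin.
by rewrite tconsE mulrA.
Qed.

(** Colinearity comes from multiplicativity [coactM] of the coaction, used at the two factors that
    are multiplied; the factors after them are handled by induction. *)
Lemma tcoact_tmerge n i (x : tpow A n.+1) : (i <= n)%N ->
  tcoact A n (tmerge i x) = tmap (tmerge i) id (tcoact A n.+1 x).
Proof.
elim: n x => [|n IHn] x lein; move: x; apply: tpowS_ext => [||y b]; try (rewrite /tmap; lin).
  rewrite tmerge0 tcoactE /tmap sw_sw; last by lin.
  rewrite [LHS]coactM; apply: eq_sw => a0 a1; rewrite sw_sw; last by lin.
  by apply: eq_sw => b0 b1; rewrite sweedler_pure ?tmerge0 //; lin.
case: (leqP i n) => [le_in|lt_ni].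
  rewrite tmergeE // !tcoactE IHn // sw_tmap; last by lin.
  rewrite /tmap [RHS]sw_sw; last by lin.
  apply: eq_sw => y0 y1; rewrite [RHS]sw_sw; last by lin.
  by apply: eq_sw => b0 b1; rewrite sweedler_pure ?tmergeE //; lin.
(* Now the last two factors are multiplied, so the tensor is decomposed once more to expose both. *)
have {lein lt_ni} -> : i = n.+1 by apply/eqP; rewrite eqn_leq lein.
move: y; apply: tpowS_ext => [||y a]; try (rewrite /tmap; lin).
rewrite tmerge_last !tcoactE /tmap !sw_sw; try lin.
apply: eq_sw => y0 y1; rewrite coactM !sw_sw; try lin.
apply: eq_sw => a0 a1; rewrite sweedler_pure; last by lin.
rewrite !sw_sw; try lin.
apply: eq_sw => b0 b1; rewrite !sweedler_pure; try lin.
by rewrite tmerge_last mulrA.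
Qed.

Lemma tcoact_tins n i (x : tpow A n) :
  tcoact A n.+1 (tins i x) = tmap (tins i) id (tcoact A n x).
Proof.
(* Appending 1 at the end serves both the base case and every index beyond the last factor; there
   [coact1] gives the claim. *)
have last m (y : tpow A m) : (m <= i)%N ->
    tcoact A m.+1 (tins i y) = tmap (tins i) id (tcoact A m y).
  move=> le_mi; rewrite tins_last // tcoactE; apply: eq_sw => y0 y1.
  by rewrite coact1 sweedler_pure ?tins_last ?mulr1 //; lin.
elim: n x => [|n IHn] x; first exact: last.
case: (leqP n.+1 i) => [/last //|]; rewrite ltnS => le_in; move: x.
apply: tpowS_ext => [||y b]; try (rewrite /tmap; lin).
rewrite tinsE // !tcoactE IHn sw_tmap; last by lin.
rewrite /tmap [RHS]sw_sw; last by lin.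
apply: eq_sw => y0 y1; rewrite [RHS]sw_sw; last by lin.
by apply: eq_sw => b0 b1; rewrite sweedler_pure ?tinsE //; lin.
Qed.

(** On y ⊗ b, coassociativity brings both sides to (b^(0) ⊗ y^(0)) ⊗ b^(2) ⊗ b^(1) y^(1) b^(3). For
    [n = 0] there is no y, and both sides are b^(0) ⊗ b^(2) ⊗ b^(1) b^(3). *)
Lemma trot_twisted n : twisted (tcoact A n) (tcoact A n) trot.
Proof.
split; first exact: trot_lin.
case: n => [x|n].
  rewrite [LHS](sw_rcoassoc (F := fun y0 y1 h => sweedler (comul H h) (fun h1 h2 =>
    y0 ⊗ h1 ⊗ (y1 * h2))) _ (coactP A)); last by split; lin.
  rewrite [RHS](sw_rcoassoc (F := fun y0 y1 h => sweedler (comul H y1) (fun h1 h2 =>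
    y0 ⊗ h2 ⊗ (h1 * h))) _ (coactP A)); last by split; lin.
  by apply: eq_sw => y h; rewrite sw_comulA //; split; lin.
apply: tpowS_ext => [||y b]; try lin.
rewrite trotE tcoactE !sw_sw; try lin.
transitivity (sweedler (coact A b) (fun c0 c1 => sweedler (coact A c0) (fun b0 b1 =>
   sweedler (tcoact A n y) (fun y0 y1 =>
   sweedler (comul H c1) (fun h1 h2 => tcons b0 y0 ⊗ h1 ⊗ (b1 * y1 * h2)))))).
  apply: eq_sw => b0 b1; rewrite sweedler_pure; last by lin.
  rewrite tcoact_tcons sw_sw; last by lin.
  apply: eq_sw => c0 c1; rewrite sw_sw; last by lin.
  by apply: eq_sw => y0 y1; rewrite sweedler_pure //; lin.
rewrite (sw_rcoassoc (F := fun b0 b1 c1 => sweedler (tcoact A n y) (fun y0 y1 =>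
   sweedler (comul H c1) (fun h1 h2 => tcons b0 y0 ⊗ h1 ⊗ (b1 * y1 * h2)))) _ (coactP A));
  last by split; lin.
transitivity (sweedler (coact A b) (fun b0 b1 => sweedler (tcoact A n y) (fun y0 y1 =>
  sweedler (trot (y0 ⊗ b0 : tpow A n.+1)) (fun z h => sweedler (comul H h) (fun h1 h2 =>
    z ⊗ h2 ⊗ (h1 * (y1 * b1))))))); last first.
  rewrite [LHS]sw_exchange; apply: eq_sw => y0 y1; rewrite [RHS]sw_sw; last by lin.
  by apply: eq_sw => b0 b1; rewrite [RHS]sweedler_pure //; lin.
rewrite [RHS]sw_exchange.
transitivity (sweedler (tcoact A n y) (fun y0 y1 => sweedler (coact A b) (fun b0 b1 =>
  sweedler (coact A b0) (fun c0 c1 => sweedler (comul H c1) (fun h1 h2 =>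
    tcons c0 y0 ⊗ h2 ⊗ (h1 * (y1 * b1))))))); last first.
  apply: eq_sw => y0 y1; apply: eq_sw => b0 b1; rewrite trotE sw_sw; last by lin.
  by apply: eq_sw => c0 c1; rewrite sweedler_pure //; lin.
transitivity (sweedler (tcoact A n y) (fun y0 y1 => sweedler (coact A b) (fun b0 b1 =>
  sweedler (comul H b1) (fun g1 g2 => sweedler (comul H g2) (fun h1 h2 =>
   tcons b0 y0 ⊗ h1 ⊗ (g1 * y1 * h2)))))).
  rewrite [RHS]sw_exchange; apply: eq_sw => b0 b1.
  by rewrite [LHS]sw_exchange.
apply: eq_sw => y0 y1.
rewrite (sw_rcoassoc (F := fun c0 c1 b1 => sweedler (comul H c1) (fun h1 h2 =>
    tcons c0 y0 ⊗ h2 ⊗ (h1 * (y1 * b1)))) _ (coactP A)); last by split; lin.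
apply: eq_sw => b0 b1; rewrite sw_comulA; last by split; lin.
by apply: eq_sw => g1 g2; apply: eq_sw => h1 h2; rewrite mulrA.
Qed.

End Families.

(** * Laws of Kleisli composition with arrows of trivial component *)

Section KleisliCategory.
Variables (k : fieldType) (H : hopfAlgebra k).
Implicit Types X Y Z V : lmodType k.

Definition kpure X Y (f : X -> Y) (x : X) : tensor Y H := f x ⊗ 1.

Lemma kpure_lin X Y (f : X -> Y) : lin f -> lin (kpure f).
Proof. by move=> fL; rewrite /kpure; lin. Qed.

Lemma kcompA_fun X Y Z V (f : Z -> tensor V H) (g : Y -> tensor Z H)
    (e : X -> tensor Y H) : lin f -> lin g ->
  kcomp f (kcomp g e) = kcomp (kcomp f g) e.
Proof. by move=> fL gL; apply/funext => x; apply: kcompA. Qed.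

Lemma kcomp_pure X Y Z (e : Y -> tensor Z H) (f : X -> Y) : lin e ->
  kcomp e (kpure f) = (fun x => e (f x)).
Proof.
move=> eL; apply/funext => x; rewrite /kcomp /kpure sweedler_pure; last by lin.
by rewrite -[RHS]sw_id; apply: eq_sw => z h; rewrite mulr1.
Qed.

Lemma pure_kcomp X Y Z (f : Y -> Z) (e : X -> tensor Y H) : lin f ->
  kcomp (kpure f) e = (fun x => tmap f id (e x)).
Proof.
move=> fL; apply/funext => x; apply: eq_sw => y h; rewrite /kpure.
by rewrite sweedler_pure ?mul1r //; lin.
Qed.

Lemma kcomp_idl X Y (e : X -> tensor Y H) : kcomp (kpure id) e = e.
Proof. by rewrite pure_kcomp //; apply/funext => x; exact: sw_id. Qed.

End KleisliCategory.

(** Compares two families at one index: all conditionals are split, impossible cases are removed by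
    arithmetic, and the rest follows from the algebra laws and equality of indices. *)
Ltac family_cases :=
  rewrite /fmerge /finsert1 /fcons /=; repeat (case: ifPn => ?);
  try (exfalso; lia);
  repeat match goal with
  | |- context [match ?i with 0 => _ | S _ => _ end] =>
      is_var i; destruct i; cbn [predn] in *; try (exfalso; lia)
  end;
  rewrite ?amulA ?amul1l ?amul1r;
  repeat (first [by [] | by congr (_ _); lia | congr (amul _ _)]).

(** * Relations between multiplications, insertions and the rotation *)

Section CyclicRelations.
Variables (k : fieldType) (H : hopfAlgebra k) (A : comodAlgebra H).
Implicit Types a : nat -> A.

Lemma tmerge_tmerge n i j (x : tpow A n.+2) : (i < j <= n.+1)%N ->
  tmerge i (tmerge j x) = tmerge j.-1 (tmerge i x).
Proof.
move=> ltij; move: x; apply: tpow_ext => [||a]; try lin.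
rewrite !tmerge_tpure; try lia.
by apply: tpure_eq => p lep; family_cases.
Qed.

Lemma tins_tins n i j (x : tpow A n) : (i <= j <= n)%N ->
  tins i (tins j x) = tins j.+1 (tins i x).
Proof.
move=> leij; move: x; apply: tpow_ext => [||a]; try lin.
rewrite !tins_tpure; try lia.
by apply: tpure_eq => p lep; family_cases.
Qed.

Lemma tmerge_tins_lt n i j (x : tpow A n.+1) : (i < j <= n.+1)%N ->
  tmerge i (tins j x) = tins j.-1 (tmerge i x).
Proof.
move=> ltij; move: x; apply: tpow_ext => [||a]; try lin.
rewrite tins_tpure ?tmerge_tpure ?tins_tpure; try lia.
by apply: tpure_eq => p lep; family_cases.
Qed.

Lemma tmerge_tins n j (x : tpow A n) : (j <= n)%N -> tmerge j (tins j x) = x.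
Proof.
move=> lejn; move: x; apply: tpow_ext => [||a]; try lin.
rewrite tins_tpure // tmerge_tpure //.
by apply: tpure_eq => p lep; family_cases.
Qed.

Lemma tmergeS_tins n j (x : tpow A n) : (j < n)%N -> tmerge j.+1 (tins j x) = x.
Proof.
move=> lejn; move: x; apply: tpow_ext => [||a]; try lin.
rewrite tins_tpure ?tmerge_tpure //; last by lia.
by apply: tpure_eq => p lep; family_cases.
Qed.

Lemma tmerge_tins_gt n i j (x : tpow A n.+1) : (j.+1 < i <= n.+1)%N ->
  tmerge i (tins j x) = tins j (tmerge i.-1 x).
Proof.
move=> ltij; move: x; apply: tpow_ext => [||a]; try lin.
rewrite tins_tpure ?tmerge_tpure ?tins_tpure; try lia.
by apply: tpure_eq => p lep; family_cases.
Qed.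

Lemma trot_tmerge n i (x : tpow A n.+1) : (1 <= i <= n)%N ->
  tmap (tmerge i) id (trot x) = trot (tmerge i.-1 x).
Proof.
move=> lein; move: x; apply: tpow_ext => [||a]; try (rewrite /tmap; lin).
rewrite tmerge_tpure ?trot_tpure; last by lia.
rewrite /tmap sw_sw; last by lin.
have -> : fmerge i.-1 a n = a n.+1 by family_cases.
apply: eq_sw => b h; rewrite sweedler_pure; last by lin.
rewrite tmerge_tpure; last by lia.
congr (_ ⊗ _); by apply: tpure_eq => -[|p] lep; family_cases.
Qed.

(** By [coactM], rotating the product of the last two factors is the same as rotating twice and
    multiplying the first two; [kcomp] collects the [H]-components in the matching order. *)
Lemma trot_tmerge_last n (x : tpow A n.+1) :
  trot (tmerge n x) = tmap (tmerge 0) id (kcomp trot trot x).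
Proof.
move: x; apply: tpow_ext => [||a].
- by lin.
- by rewrite /tmap /kcomp; lin.
rewrite tmerge_tpure // !trot_tpure /kcomp trot_tpure.
have -> : fmerge n a n = amul (a n) (a n.+1) by family_cases.
rewrite coactM [LHS]sw_sw; last by lin.
transitivity (sweedler (coact A (a n)) (fun u v => sweedler (coact A (a n.+1)) (fun b h =>
  tpure n (fcons (amul u b) (fmerge n a)) ⊗ (v * h)))).
  apply: eq_sw => u v; rewrite sw_sw; last by lin.
  by apply: eq_sw => b h; rewrite sweedler_pure //; lin.
rewrite sw_exchange; rewrite [in RHS]sw_sw; last by lin.
rewrite /tmap sw_sw; last by lin.
apply: eq_sw => b h; rewrite sweedler_pure; last by lin.
rewrite trot_tpure sw_sw; last by lin.
rewrite sw_sw; last by lin.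
apply: eq_sw => u v; rewrite sweedler_pure; last by lin.
rewrite sweedler_pure; last by lin.
rewrite tmerge_tpure //; congr (_ ⊗ _).
by apply: tpure_eq => -[|[|p]] lep; family_cases.
Qed.

Lemma tmerge_trot_tins n (x : tpow A n) :
  tmap (tmerge 0) id (trot (tins n x)) = x ⊗ 1.
Proof.
move: x; apply: tpow_ext => [||a]; try (rewrite /tmap; lin).
rewrite tins_tpure // trot_tpure.
have -> : finsert1 n a n.+1 = aone by family_cases.
rewrite coact1 sweedler_pure /tmap; last by lin.
rewrite sweedler_pure ?tmerge_tpure //; last by lin.
by congr (_ ⊗ _); apply: tpure_eq => -[|p] lep; family_cases.
Qed.

Lemma tins_trot n i (x : tpow A n) : (1 <= i <= n)%N ->
  tmap (tins i) id (trot x) = trot (tins i.-1 x).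
Proof.
move=> lein; move: x; apply: tpow_ext => [||a]; try (rewrite /tmap; lin).
rewrite tins_tpure ?trot_tpure; last by lia.
rewrite /tmap sw_sw; last by lin.
have -> : finsert1 i.-1 a n.+1 = a n by family_cases.
apply: eq_sw => b h; rewrite sweedler_pure; last by lin.
rewrite tins_tpure; last by lia.
by congr (_ ⊗ _); apply: tpure_eq => -[|p] lep; family_cases.
Qed.

(** The first rotation on the right brings the appended 1 to the front with trivial [H]-component by
    [coact1]; the second puts the former last factor before it. *)
Lemma tins0_trot n (x : tpow A n) :
  tmap (tins 0) id (trot x) = kcomp trot trot (tins n x).
Proof.
move: x; apply: tpow_ext => [||a].
- by rewrite /tmap; lin.
- by rewrite /kcomp; lin.
rewrite tins_tpure // /kcomp !trot_tpure /tmap sw_sw; last by lin.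
have -> : finsert1 n a n.+1 = aone by family_cases.
rewrite coact1 sweedler_pure; last by lin.
rewrite sweedler_pure; last by lin.
rewrite trot_tpure sw_sw; last by lin.
have -> : fcons aone (finsert1 n a) n.+1 = a n by family_cases.
apply: eq_sw => b h; rewrite !sweedler_pure; try lin.
rewrite tins_tpure // mulr1.
by congr (_ ⊗ _); apply: tpure_eq => -[|[|p]] lep; family_cases.
Qed.

(** * Faces, degeneracies and rotation as arrows *)

Local Notation "g ∘ e" := (kcomp g e) (at level 50, left associativity).
Local Notation M i := (kpure H (tmerge i)).
Local Notation I i := (kpure H (tins i)).
Local Notation T := (trot (A := A)).

Definition face n i : tpow A n.+1 -> tensor (tpow A n) H :=
  if (i <= n)%N then M i else M 0 ∘ T.
Arguments face n i x : clear implicits.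

Definition degen n i : tpow A n -> tensor (tpow A n.+1) H := I i.
Arguments degen n i x : clear implicits.

Lemma face_lt n i : (i <= n)%N -> face n i = M i.
Proof. by rewrite /face => ->. Qed.

Lemma face_last n : face n n.+1 = M 0 ∘ T.
Proof. by rewrite /face ltnn. Qed.

Lemma kmerge_lin n i : lin (M i : tpow A n.+1 -> _).
Proof. by apply: kpure_lin; lin. Qed.

Lemma degen_lin n i : lin (degen n i).
Proof. by apply: kpure_lin; lin. Qed.

Lemma face_lin n i : lin (face n i).
Proof.
rewrite /face; case: ifP => _; first exact: kmerge_lin.
by apply: kcomp_lin; [exact: kmerge_lin | exact: trot_lin].
Qed.

Lemma merge_mergeK n i j : (i < j <= n.+1)%N ->
  M i ∘ M j = M j.-1 ∘ M i :> (tpow A n.+2 -> tensor (tpow A n) H).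
Proof.
move=> ltij; rewrite !kcomp_pure; try exact: kmerge_lin.
by apply/funext => x; rewrite /kpure tmerge_tmerge.
Qed.

Lemma trot_mergeK n i : (1 <= i <= n)%N ->
  M i ∘ T = T ∘ M i.-1 :> (tpow A n.+1 -> tensor (tpow A n) H).
Proof.
move=> lei; rewrite kcomp_pure ?pure_kcomp; last exact: trot_lin; last by lin.
by apply/funext => x; rewrite trot_tmerge.
Qed.

Lemma trot_merge_lastK n :
  T ∘ M n = M 0 ∘ (T ∘ T) :> (tpow A n.+1 -> tensor (tpow A n) H).
Proof.
rewrite kcomp_pure ?pure_kcomp; last exact: trot_lin; last by lin.
by apply/funext => x; rewrite trot_tmerge_last.
Qed.

Lemma trot_insK n i : (1 <= i <= n)%N ->
  I i ∘ T = T ∘ I i.-1 :> (tpow A n -> tensor (tpow A n.+1) H).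
Proof.
move=> lei; rewrite kcomp_pure ?pure_kcomp; last exact: trot_lin; last by lin.
by apply/funext => x; rewrite tins_trot.
Qed.

Lemma trot_ins0K n :
  I 0 ∘ T = T ∘ T ∘ I n :> (tpow A n -> tensor (tpow A n.+1) H).
Proof.
rewrite -kcompA_fun; try exact: trot_lin.
rewrite pure_kcomp; last by lin.
apply/funext => x; rewrite tins0_trot kcompA_fun; try exact: trot_lin.
by rewrite kcomp_pure //; apply: kcomp_lin; exact: trot_lin.
Qed.

Lemma merge_trot_insK n : M 0 ∘ T ∘ I n = kpure H (@id (tpow A n)).
Proof.
rewrite -kcompA_fun ?kcomp_pure ?pure_kcomp; try exact: trot_lin; try exact: kmerge_lin.
  by apply/funext => x; rewrite tmerge_trot_tins.
by lin.
Qed.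

Lemma merge_ins_ltK n i j : (i < j <= n.+1)%N ->
  M i ∘ I j = I j.-1 ∘ M i :> (tpow A n.+1 -> tensor (tpow A n.+1) H).
Proof.
move=> ltij; rewrite !kcomp_pure; try exact: kmerge_lin; try exact: degen_lin.
by apply/funext => x; rewrite /kpure tmerge_tins_lt.
Qed.

(* The cyclic identities for arrows *)
#[local] Opaque kcomp tmerge tins trot.

Lemma face_face n i j : (i < j <= n.+2)%N ->
  face n i ∘ face n.+1 j = face n j.-1 ∘ face n.+1 i.
Proof.
have ML := kmerge_lin; have TL := @trot_lin k H A.
case: (ltngtP j n.+2) => [ltj|ltj|->] leij.
  rewrite !face_lt; try lia.
  by apply: merge_mergeK; lia.
  by move: leij; rewrite andbF.
rewrite -[n.+2.-1]/(n.+1) !face_last [face n.+1 i]face_lt; last by lia.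
(* Here [j = n.+2], so a rotation occurs on both sides. For [i <= n], M i ∘ M 0 is M 0 ∘ M (i+1),
   and the second factor passes through the rotation as M i. *)
case: (leqP i n) => [lein|ltni].
  rewrite face_lt //; rewrite kcompA_fun //.
  rewrite -(merge_mergeK (i := 0) (j := i.+1)); last by lia.
  rewrite -!kcompA_fun // trot_mergeK //; lia.
(* Both sides now reduce to two rotations followed by two multiplications at the front, M 0 ∘ M 1 on
   one side and M 0 ∘ M 0 on the other. *)
have -> : i = n.+1 by lia.
rewrite face_last -!kcompA_fun // trot_merge_lastK.
rewrite [T ∘ (M 0 ∘ T)]kcompA_fun // -[T ∘ M 0](trot_mergeK (i := 1)) //.
rewrite -[M 1 ∘ T ∘ T]kcompA_fun // ![M 0 ∘ (_ ∘ _)]kcompA_fun //.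
by rewrite (merge_mergeK (i := 0) (j := 1)).
Qed.

Lemma degen_degen n i j : (i <= j <= n)%N ->
  degen n.+1 i ∘ degen n j = degen n.+1 j.+1 ∘ degen n i.
Proof.
move=> leij; rewrite !kcomp_pure; try exact: degen_lin.
by apply/funext => x; rewrite /degen /kpure tins_tins.
Qed.

Lemma face_degen_lt n i j : (i < j <= n.+1)%N ->
  face n.+1 i ∘ degen n.+1 j = degen n j.-1 ∘ face n i.
Proof. by move=> ltij; rewrite !face_lt; [exact: merge_ins_ltK | lia..]. Qed.

Lemma face_degen_eq n j : (j <= n)%N -> face n j ∘ degen n j = kpure H id.
Proof.
move=> lejn; rewrite face_lt // kcomp_pure; last exact: kmerge_lin.
by apply/funext => x; rewrite /kpure tmerge_tins.
Qed.

Lemma face_degen_eqS n j : (j <= n)%N -> face n j.+1 ∘ degen n j = kpure H id.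
Proof.
rewrite leq_eqVlt => /predU1P[->|ltjn].
  by rewrite face_last; exact: merge_trot_insK.
rewrite face_lt // kcomp_pure; last exact: kmerge_lin.
by apply/funext => x; rewrite /kpure tmergeS_tins.
Qed.

Lemma face_degen_gt n i j : (j.+1 < i <= n.+2)%N ->
  face n.+1 i ∘ degen n.+1 j = degen n j ∘ face n i.-1.
Proof.
have ML := kmerge_lin; have TL := @trot_lin k H A; have DL := degen_lin.
have IL m l : lin (I l : tpow A m -> _) := @degen_lin m l.
case: (ltngtP i n.+2) => [lti|lti|->] ltji.
- rewrite !face_lt; try lia.
  rewrite !kcomp_pure //.
  by apply/funext => x; rewrite /degen /kpure tmerge_tins_gt //; lia.
- by lia.
rewrite -[n.+2.-1]/(n.+1) !face_last /degen -kcompA_fun //.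
rewrite -[T ∘ I j](trot_insK (i := j.+1)) ?kcompA_fun //; try lia.
by rewrite (merge_ins_ltK (i := 0) (j := j.+1)) //; lia.
Qed.

Lemma face_trot n i : (1 <= i <= n.+1)%N -> face n i ∘ T = T ∘ face n i.-1.
Proof.
have ML := kmerge_lin; have TL := @trot_lin k H A.
case: (ltngtP i n.+1) => [lti|lti|->] lei.
- by rewrite !face_lt ?trot_mergeK //; lia.
- by lia.
by rewrite face_last face_lt // trot_merge_lastK kcompA_fun.
Qed.

Lemma face_trot0 n : face n 0 ∘ T = face n n.+1.
Proof. by rewrite face_lt // face_last. Qed.

Lemma degen_trot n i : (1 <= i <= n)%N -> degen n i ∘ T = T ∘ degen n i.-1.
Proof. exact: trot_insK. Qed.

Lemma degen_trot0 n : degen n 0 ∘ T = T ∘ T ∘ degen n n.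
Proof. exact: trot_ins0K. Qed.

(* Powers of the rotation and the diagonal coaction *)
#[local] Transparent kcomp.

(** Composing with the rotation on the right lets an unfolding expose the rotation performed first,
    that of the last factor, in step with the recursion of [tcoact]. *)
Definition trot_iter n j : tpow A n -> tensor (tpow A n) H :=
  iter j (fun e => e ∘ T) (kpure H id).
Arguments trot_iter n j x : clear implicits.

Lemma trot_iter_lin n j : lin (trot_iter n j).
Proof.
elim: j => [|j IHj]; first exact: kpure_lin.
by apply: kcomp_lin => //; exact: trot_lin.
Qed.

Definition fset p (b : A) a i := if i == p then b else a i.

Lemma tpure_fset_lin n p a : (p <= n)%N -> lin (fun b => tpure n (fset p b a)).
Proof.
elim: n => [|n IHn]; first by case: p => // _; exact: lin_id.
rewrite leq_eqVlt => /predU1P[->|ltpn] c x y; rewrite !tpureS /fset.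
  rewrite !eqxx -[LHS]/(_ ⊗ (c *: x + y)) pureDr pureZr.
  by congr (c *: (_ ⊗ _) + _ ⊗ _); apply: tpure_eq => i lein; rewrite ltn_eqF.
rewrite gtn_eqF // -/(fset p x a) -/(fset p y a) -/(fset p (c *: x + y) a).
by rewrite (IHn ltpn) pureDl pureZl.
Qed.

Lemma fcons_fset p b b' a : fcons b (fset p b' a) = fset p.+1 b' (fcons b a).
Proof. by apply/funext => -[]. Qed.

Lemma fcons_fset0 b a : fcons b a = fset 0 b (fcons aone a).
Proof. by apply/funext => -[]. Qed.

(* [glue] is the linear extension in its first argument of
   [a |-> a 0 ⊗ ... ⊗ a j ⊗ c 0 ⊗ ... ⊗ c (n - j - 1)]. *)
Fixpoint glue n j : tpow A j -> (nat -> A) -> tpow A n :=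
  match j return tpow A j -> (nat -> A) -> tpow A n with
  | 0 => fun b c => tpure n (fcons b c)
  | j'.+1 => fun x c => sweedler x (fun y b => glue n y (fcons b c))
  end.
Arguments glue n {j} x c.

Lemma glue_fset_lin n j (y : tpow A j) p c : (p + j < n)%N ->
  lin (fun b => glue n y (fset p b c)).
Proof.
elim: j y p c => [|j IHj] y p c ltpjn.
  move=> s x z; rewrite [LHS]/= [in RHS]/= !fcons_fset.
  by apply: tpure_fset_lin; rewrite -(addn0 p).
apply: lin_sw => z b s x w; rewrite !fcons_fset.
by apply: IHj; rewrite addSnnS.
Qed.

(** The strict bound matters: for [j = n] the entry [b] would fall beyond position [n], where
    [tpure] ignores it, and the map would be constant in [b]. *)
Lemma glue_bilin n j c : (j < n)%N ->
  bilin (fun (y : tpow A j) b => glue n y (fcons b c)).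
Proof.
elim: j c => [|j IHj] c ltjn; apply: bilinI => [b|y].
- exact: tpure_fcons_lin.
- by move=> s x z; rewrite (fcons_fset0 (_ + _)) (fcons_fset0 x) (fcons_fset0 z);
  apply: glue_fset_lin.
- by apply: lin_sw_arg; [apply: IHj; exact: ltnW | lin].
- by move=> s x z; rewrite (fcons_fset0 (_ + _)) (fcons_fset0 x) (fcons_fset0 z);
  apply: glue_fset_lin.
Qed.

Lemma glue_lin n j c : (j <= n)%N -> lin (fun y : tpow A j => glue n y c).
Proof.
case: j => [_|j ltjn]; first exact: tpure_fcons_lin.
by apply: lin_sw_arg; [exact: glue_bilin | lin].
Qed.

Lemma glueS n j (y : tpow A j) b c : (j < n)%N ->
  glue n (y ⊗ b : tpow A j.+1) c = glue n y (fcons b c).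
Proof. by move=> ltjn; rewrite [LHS]sweedler_pure //; exact: glue_bilin. Qed.

Lemma glue_tpure n j a c : (j <= n)%N ->
  glue n (tpure j a) c = tpure n (fun i => if (i <= j)%N then a i else c (i - j.+1)%N).
Proof.
elim: j c => [|j IHj] c lejn.
  by apply: tpure_eq => -[|i] _ //=; rewrite subSS subn0.
rewrite tpureS glueS // IHj; last exact: ltnW.
apply: tpure_eq => i _; rewrite -[(i <= j)%N]/(i < j.+1)%N.
by case: (ltngtP i j.+1) => [//|lt_ji|->]; rewrite -?(subnSK lt_ji) ?subnn.
Qed.

Lemma glue_id n (x : tpow A n) c : glue n x c = x.
Proof.
move: x; apply: tpow_ext => [||a].
- exact: glue_lin.
- exact: lin_id.
by rewrite glue_tpure //; apply: tpure_eq => i ->.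
Qed.

(** The induction needs an intermediate stage: the last [j.+1] entries of [c] are the a 0, ..., a j
    still to be rotated. Moving them to the front leaves the first [n - j] entries of [c] behind
    them, and since later rotations multiply on the left, the components appear in the order of the
    diagonal coaction. *)
Lemma trot_iterS n j a c : (j <= n)%N ->
  (forall i, (i <= j)%N -> c (i + (n - j))%N = a i) ->
  trot_iter n j.+1 (tpure n c) =
  sweedler (tcoact A j (tpure j a)) (fun y h => glue n y c ⊗ h).
Proof.
have TL := trot_iter_lin; elim: j c => [|j IHj] c lejn ca.
  rewrite -[LHS]/(kcomp (kpure H id) T (tpure n c)) kcomp_idl trot_tpure.
  by rewrite -[tpure 0 a]/(a 0%N) -(ca 0%N) // add0n subn0.
rewrite -[LHS]/(kcomp (trot_iter n j.+1) T (tpure n c)) /kcomp trot_tpure.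
have -> : c n = a j.+1 by rewrite -ca // subnKC.
rewrite sw_sw; last by have := TL n j.+1; lin.
transitivity (sweedler (coact A (a j.+1)) (fun b h =>
    sweedler (tcoact A j (tpure j a)) (fun y l => glue n y (fcons b c) ⊗ (l * h)))).
  apply: eq_sw => b h; rewrite sweedler_pure; last by have := TL n j.+1; lin.
  have cb i : (i <= j)%N -> fcons b c (i + (n - j))%N = a i.
    by move=> leij; rewrite -ca 1?ltnW // -(subnSK lejn) addnS.
  rewrite (IHj _ (ltnW lejn) cb).
  rewrite sw_sw; last by lin.
  apply: eq_sw => y l; rewrite sweedler_pure //; lin.
rewrite tpureS tcoactE [LHS]sw_exchange [RHS]sw_sw; last first.
  have GL := glue_lin c lejn.
  by apply: bilinI => z; lin.
apply: eq_sw => y l; rewrite [RHS]sw_sw; last first.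
  have GL := glue_lin c lejn.
  by apply: bilinI => z; lin.
apply: eq_sw => b h; rewrite sweedler_pure ?glueS //.
have GL := glue_lin c lejn.
by apply: bilinI => z; lin.
Qed.

Lemma trot_iter_coact n (x : tpow A n) : trot_iter n n.+1 x = tcoact A n x.
Proof.
move: x; apply: tpow_ext => [||a]; [exact: trot_iter_lin | lin |].
rewrite (trot_iterS (a := a)) // => [|i _]; last by rewrite subnn addn0.
by rewrite -[RHS]sw_id; apply: eq_sw => y h; rewrite glue_id.
Qed.

Lemma face_twisted n i : twisted (tcoact A n.+1) (tcoact A n) (face n i).
Proof.
have MT j : (j <= n)%N -> twisted (tcoact A n.+1) (tcoact A n) (M j).
  move=> lejn; apply: kpure_twisted; first by lin.
  by move=> x; exact: tcoact_tmerge.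
rewrite /face; case: leqP => [/MT //|_].
by apply: kcomp_twisted; [exact: MT | exact: trot_twisted].
Qed.

Lemma degen_twisted n i : twisted (tcoact A n) (tcoact A n.+1) (degen n i).
Proof.
apply: kpure_twisted; first by lin.
by move=> x; exact: tcoact_tins.
Qed.

End CyclicRelations.

Arguments face {k H} A n i x.
Arguments degen {k H} A n i x.
Arguments trot_iter {k H} A n j x.

(** * Bundled linear maps *)

Section Bundling.
Variables (k : fieldType) (U V : lmodType k) (f : U -> V).
Hypothesis fL : lin f.

HB.instance Definition _ := GRing.isLinear.Build k U V *:%R f fL.

Definition mklin : {linear U -> V} := f.

End Bundling.

(** * The induced operators as linear maps between the modules of the theorem *)

Section Actions.
Variables (k : fieldType) (H : hopfAlgebra k) (Sinv : H -> H).
Hypotheses (antipodeK : cancel (antipode H) Sinv)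
  (antipodeVK : cancel Sinv (antipode H)).
Variables (X Y : lmodType k) (rhoX : {linear X -> tensor X H})
  (rhoY : {linear Y -> tensor Y H}) (e : X -> tensor Y H).
Hypothesis eT : twisted rhoX rhoY e.

Section Pull.
Variables (M : rmodComod H) (MA : is_rAYD Sinv M).

Definition pull_colin (f : colinMap rhoY (rcoact M)) : colinMap rhoX (rcoact M) :=
  ColinMap (pull_colinear antipodeK antipodeVK MA eT (colin_funP f)).

Fact pull_colin_lin : lin pull_colin.
Proof.
move=> c f g; apply/val_inj/funext => x; rewrite linearP /=.
rewrite -[RHS]/(c *: pull_fun e f x + pull_fun e g x) /pull_fun.
rewrite /sweedler scaler_sumr -big_split; apply: eq_bigr => p _ /=.
rewrite -[LHS]/(ract (val (c *: f + g) p.1) p.2) linearP.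
exact: ((ract_bilin M).1 p.2 c (f p.1) (g p.1)).
Qed.

Definition pull : {linear colinMap rhoY (rcoact M) -> colinMap rhoX (rcoact M)} :=
  mklin pull_colin_lin.

End Pull.

Section Push.
Variables (M : lmodComod H) (MA : is_lAYD Sinv M).

Definition push_cot (z : cotensor rhoX (lcoact M)) : cotensor rhoY (lcoact M) :=
  Cotensor (push_cotensor antipodeK antipodeVK MA eT (cotensor_valP z)).

Fact push_cot_lin : lin push_cot.
Proof.
move=> c y z; apply/val_inj; rewrite linearP /= -[RHS]/(c *: push_fun e y + push_fun e z).
rewrite -[LHS]/(push_fun e (val (c *: y + z))) linearP.
by apply: push_fun_lin; exact: eT.1.
Qed.

Definition push : {linear cotensor rhoX (lcoact M) -> cotensor rhoY (lcoact M)} :=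
  mklin push_cot_lin.

Lemma pushE z : push z = push_fun e z :> tensor Y M.
Proof. by []. Qed.

End Push.

End Actions.

(** * Operators induced by trivial arrows and by the coaction *)

Section Evaluation.
Variables (k : fieldType) (H : hopfAlgebra k).
Implicit Types X Y Z : lmodType k.

Lemma colin_lin X Y (rhoX : {linear X -> tensor X H}) (rhoY : {linear Y -> tensor Y H})
  (f : colinMap rhoX rhoY) : lin f.
Proof. by case/asboolP: (colin_funP f). Qed.

Lemma colin_ext X Y (rhoX : {linear X -> tensor X H}) (rhoY : {linear Y -> tensor Y H})
  (f g : colinMap rhoX rhoY) : (forall x, f x = g x) -> f = g.
Proof. by move=> fg; apply/val_inj/funext. Qed.

Lemma pull_kpure X Y (M : rmodComod H) (g : X -> Y) (f : Y -> M) x :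
  lin f -> pull_fun (kpure H g) f x = f (g x).
Proof. by move=> fL; rewrite /pull_fun sweedler_pure ?ract1 //; lin. Qed.

Lemma pull_id X (M : rmodComod H) (f : X -> M) x :
  lin f -> pull_fun (kpure H id) f x = f x.
Proof. exact: pull_kpure. Qed.

Lemma push_fun_pure X Y (M : lmodComod H) (e : X -> tensor Y H) x (m : M) :
  lin e -> push_fun e (x ⊗ m) = sweedler (e x) (fun y h => y ⊗ lact h m).
Proof. by move=> eL; rewrite /push_fun sweedler_pure //; lin. Qed.

Lemma push_kpure X Y (M : lmodComod H) (g : X -> Y) x (m : M) :
  lin g -> push_fun (kpure H g) (x ⊗ m) = g x ⊗ m.
Proof.
move=> gL; rewrite push_fun_pure; last exact: kpure_lin.
by rewrite sweedler_pure ?lact1 //; lin.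
Qed.

Lemma push_id X (M : lmodComod H) (z : tensor X M) : push_fun (kpure H id) z = z.
Proof.
move: z; apply: tensor_ext => [||x m]; last exact: push_kpure.
  by apply: push_fun_lin; apply: kpure_lin; lin.
exact: lin_id.
Qed.

(** Colinearity turns f(x^(0)) x^(1) into m^(0) m^(1) for m = f(x), which is m by stability. *)
Lemma pull_coaction X (M : rmodComod H) (rhoX : {linear X -> tensor X H})
  (f : colinMap rhoX (rcoact M)) x : rstable M -> pull_fun rhoX f x = f x.
Proof.
move=> Ms; have /asboolP[_ fC] := colin_funP f; rewrite -[RHS]Ms fC.
by rewrite sw_tmap //; lin.
Qed.

(** The cotensor condition turns x^(0) ⊗ x^(1) m into x ⊗ m^(-1) m^(0), and stability applies. *)
Lemma push_coaction X (M : lmodComod H) (rhoX : {linear X -> tensor X H})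
  (z : cotensor rhoX (lcoact M)) : lstable M -> push_fun rhoX z = z.
Proof.
move=> Ms; rewrite /push_fun.
rewrite (cotensor_app (G := fun x h m => x ⊗ lact h m) (cotensor_valP z)); last by split; lin.
rewrite -[RHS]sw_id; apply: eq_sw => x m; rewrite -{2}(Ms m).
by rewrite -(sw_lin (f := fun m => x ⊗ m)) //; lin.
Qed.

End Evaluation.

(** * The cocyclic and cyclic modules *)

Section CyclicModules.
Variables (k : fieldType) (H : hopfAlgebra k) (Sinv : H -> H).
Hypotheses (antipodeK : cancel (antipode H) Sinv)
  (antipodeVK : cancel Sinv (antipode H)).
Variable A : comodAlgebra H.

Let FL n i : lin (face A n i) := @face_lin k H A n i.
Let DL n i : lin (degen A n i) := @degen_lin k H A n i.
Let TL n : lin (trot (A := A) (n := n)) := @trot_lin k H A n.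
Let IL n j : lin (trot_iter A n j) := @trot_iter_lin k H A n j.
Let ML n i : lin (kpure H (tmerge i) : tpow A n.+1 -> _) := @kmerge_lin k H A n i.

(** Matches the last face built from arrows, which rotates and then multiplies at the front, with
    the formula a_n^(0) a_0. *)
Lemma fmerge0_fcons n b (a : nat -> A) :
  tpure n (fmerge 0 (fcons b a)) = tpure n (fmulhead b a).
Proof. by apply: tpure_eq => -[]. Qed.

Section Cocyclic.
Variables (M : rmodComod H) (MA : is_rAYD Sinv M).

Definition hom_face n i : {linear homC A M n -> homC A M n.+1} :=
  pull antipodeK antipodeVK (face_twisted A n i) MA.

Definition hom_degen n i : {linear homC A M n.+1 -> homC A M n} :=
  pull antipodeK antipodeVK (degen_twisted A n i) MA.

Definition hom_rot n : {linear homC A M n -> homC A M n} :=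
  pull antipodeK antipodeVK (trot_twisted A n) MA.

Let fL n (f : homC A M n) : lin f := colin_lin f.

Lemma hom_faceE n i f : hom_face n i f =1 pull_fun (face A n i) f.
Proof. by []. Qed.

Lemma hom_degenE n i f : hom_degen n i f =1 pull_fun (degen A n i) f.
Proof. by []. Qed.

Lemma hom_rotE n f : hom_rot n f =1 pull_fun trot f.
Proof. by []. Qed.

Lemma hom_face_tpure n i f (a : nat -> A) : (i <= n)%N ->
  hom_face n i f (tpure n.+1 a) = f (tpure n (fmerge i a)).
Proof. by move=> lein; rewrite hom_faceE face_lt // pull_kpure // tmerge_tpure. Qed.

Lemma hom_face_last_tpure n f (a : nat -> A) :
  hom_face n n.+1 f (tpure n.+1 a) =
  sweedler (coact A (a n.+1)) (fun b h => ract (f (tpure n (fmulhead b a))) h).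
Proof.
have L := fL f; rewrite hom_faceE face_last -pull_kcomp // {1}/pull_fun trot_tpure.
rewrite sw_sw; last by rewrite /pull_fun /kpure; lin.
apply: eq_sw => b h; rewrite sweedler_pure; last by rewrite /pull_fun /kpure; lin.
by rewrite pull_kpure // tmerge_tpure // fmerge0_fcons.
Qed.

Lemma hom_degen_tpure n i f (a : nat -> A) : (i <= n)%N ->
  hom_degen n i f (tpure n a) = f (tpure n.+1 (finsert1 i a)).
Proof. by move=> lein; rewrite hom_degenE pull_kpure // tins_tpure. Qed.

Lemma hom_rot_tpure n f (a : nat -> A) : hom_rot n f (tpure n a) =
  sweedler (coact A (a n)) (fun b h => ract (f (tpure n (fcons b a))) h).
Proof.
have L := fL f; rewrite hom_rotE /pull_fun trot_tpure sw_sw; last by lin.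
by apply: eq_sw => b h; rewrite sweedler_pure //; lin.
Qed.

Lemma hom_rot_iter n j f x : iter j (hom_rot n) f x = pull_fun (trot_iter A n j) f x.
Proof.
elim: j x => [|j IHj] x; first by rewrite [RHS]pull_id.
rewrite iterS hom_rotE -[RHS](pull_kcomp trot); [|exact: fL|exact: IL].
by apply: eq_sw => y h; rewrite IHj.
Qed.

(** Pulling back reverses composition, so the cosimplicial identities are the simplicial identities
    of arrows read in the opposite order. *)
Lemma hom_cocyclic : rstable M -> is_cocyclic hom_face hom_degen hom_rot.
Proof.
move=> Ms; split.
- move=> n i j f ltij; apply: colin_ext => x.
  by rewrite [LHS]pull_kcomp // [RHS]pull_kcomp // face_face.
- move=> n i j f leij; apply: colin_ext => x.
  by rewrite [LHS]pull_kcomp // [RHS]pull_kcomp // degen_degen.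
- move=> n i j f ltij; apply: colin_ext => x.
  by rewrite [LHS]pull_kcomp // [RHS]pull_kcomp // face_degen_lt.
- move=> n j f lejn; apply: colin_ext => x.
  by rewrite [LHS]pull_kcomp // face_degen_eq // pull_id.
- move=> n j f lejn; apply: colin_ext => x.
  by rewrite [LHS]pull_kcomp // face_degen_eqS // pull_id.
- move=> n i j f ltji; apply: colin_ext => x.
  by rewrite [LHS]pull_kcomp // [RHS]pull_kcomp // face_degen_gt.
- move=> n i f lei; apply: colin_ext => x.
  by rewrite [LHS]pull_kcomp // [RHS]pull_kcomp // face_trot.
- move=> n f; apply: colin_ext => x.
  by rewrite [LHS]pull_kcomp // face_trot0.
- move=> n i f lei; apply: colin_ext => x.
  by rewrite [LHS]pull_kcomp // [RHS]pull_kcomp // degen_trot.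
- move=> n f; apply: colin_ext => x.
  rewrite [LHS]pull_kcomp // [RHS]pull_kcomp // [RHS]pull_kcomp //.
  by rewrite kcompA_fun // degen_trot0.
- move=> n f; apply: colin_ext => x; rewrite hom_rot_iter.
  by rewrite (funext (@trot_iter_coact k H A n)) pull_coaction.
Qed.

End Cocyclic.

Section Cyclic.
Variables (M : lmodComod H) (MA : is_lAYD Sinv M).

Definition cot_face n i : {linear cotC A M n.+1 -> cotC A M n} :=
  push antipodeK antipodeVK (face_twisted A n i) MA.

Definition cot_degen n i : {linear cotC A M n -> cotC A M n.+1} :=
  push antipodeK antipodeVK (degen_twisted A n i) MA.

Definition cot_rot n : {linear cotC A M n -> cotC A M n} :=
  push antipodeK antipodeVK (trot_twisted A n) MA.

(** Single pure tensors need not lie in the cotensor product, so the formulas are evaluated on an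
    arbitrary presentation of an element as a sum. *)
Lemma push_fun_sum (X Y : lmodType k) (e : X -> tensor Y H) I (r : seq I)
    (F : I -> X) (G : I -> M) : lin e -> push_fun e (\sum_(p <- r) F p ⊗ G p) =
  \sum_(p <- r) sweedler (e (F p)) (fun y h => y ⊗ lact h (G p)).
Proof.
move=> eL; rewrite lin_sum; last exact: push_fun_lin.
by apply: eq_bigr => p _; rewrite push_fun_pure.
Qed.

Lemma cot_face_tpure n i (x : cotC A M n.+1) (r : seq ((nat -> A) * M)) : (i <= n)%N ->
  cotensor_val x = \sum_(p <- r) tpure n.+1 p.1 ⊗ p.2 ->
  cotensor_val (cot_face n i x) = \sum_(p <- r) tpure n (fmerge i p.1) ⊗ p.2.
Proof.
move=> lein xr; rewrite [LHS]pushE xr push_fun_sum //; apply: eq_bigr => p _.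
by rewrite face_lt // sweedler_pure ?tmerge_tpure ?lact1 //; lin.
Qed.

Lemma trot_tpure_act n (a : nat -> A) (m : M) :
  sweedler (trot (tpure n a)) (fun y h => y ⊗ lact h m) =
  sweedler (coact A (a n)) (fun b h => tpure n (fcons b a) ⊗ lact h m).
Proof.
rewrite trot_tpure sw_sw; last by lin.
by apply: eq_sw => b h; rewrite sweedler_pure //; lin.
Qed.

Lemma cot_face_last_tpure n (x : cotC A M n.+1) (r : seq ((nat -> A) * M)) :
  cotensor_val x = \sum_(p <- r) tpure n.+1 p.1 ⊗ p.2 ->
  cotensor_val (cot_face n n.+1 x) =
  \sum_(p <- r) sweedler (coact A (p.1 n.+1)) (fun b h =>
    tpure n (fmulhead b p.1) ⊗ lact h p.2).
Proof.
move=> xr; rewrite [LHS]pushE xr face_last -push_kcomp // push_fun_sum //.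
rewrite lin_sum; last exact: push_fun_lin.
apply: eq_bigr => p _; rewrite trot_tpure_act.
rewrite (sw_lin (f := push_fun _)); last exact: push_fun_lin.
apply: eq_sw => b h; rewrite push_kpure; last by lin.
by rewrite tmerge_tpure // fmerge0_fcons.
Qed.

Lemma cot_degen_tpure n i (x : cotC A M n) (r : seq ((nat -> A) * M)) : (i <= n)%N ->
  cotensor_val x = \sum_(p <- r) tpure n p.1 ⊗ p.2 ->
  cotensor_val (cot_degen n i x) = \sum_(p <- r) tpure n.+1 (finsert1 i p.1) ⊗ p.2.
Proof.
move=> lein xr; rewrite [LHS]pushE xr push_fun_sum //; apply: eq_bigr => p _.
by rewrite sweedler_pure ?tins_tpure ?lact1 //; lin.
Qed.

Lemma cot_rot_tpure n (x : cotC A M n) (r : seq ((nat -> A) * M)) :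
  cotensor_val x = \sum_(p <- r) tpure n p.1 ⊗ p.2 ->
  cotensor_val (cot_rot n x) =
  \sum_(p <- r) sweedler (coact A (p.1 n)) (fun b h =>
    tpure n (fcons b p.1) ⊗ lact h p.2).
Proof.
move=> xr; rewrite [LHS]pushE xr push_fun_sum //.
by apply: eq_bigr => p _; rewrite trot_tpure_act.
Qed.

Lemma cot_rot_iter n j (x : cotC A M n) :
  cotensor_val (iter j (cot_rot n) x) = push_fun (trot_iter A n j) x.
Proof.
elim: j x => [|j IHj] x; first by rewrite [RHS]push_id.
(* Pushing forward preserves composition, so the innermost rotation is split off; for pulling back
   it is the outermost one. *)
by rewrite iterSr IHj -[RHS](push_kcomp trot).
Qed.

Lemma cot_cyclic : lstable M -> is_cyclic cot_face cot_degen cot_rot.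
Proof.
move=> Ms; split.
- move=> n i j x ltij; apply: val_inj.
  by rewrite [LHS]push_kcomp // [RHS]push_kcomp // face_face.
- move=> n i j x leij; apply: val_inj.
  by rewrite [LHS]push_kcomp // [RHS]push_kcomp // degen_degen.
- move=> n i j x ltij; apply: val_inj.
  by rewrite [LHS]push_kcomp // [RHS]push_kcomp // face_degen_lt.
- move=> n j x lejn; apply: val_inj.
  by rewrite [LHS]push_kcomp // face_degen_eq // push_id.
- move=> n j x lejn; apply: val_inj.
  by rewrite [LHS]push_kcomp // face_degen_eqS // push_id.
- move=> n i j x ltji; apply: val_inj.
  by rewrite [LHS]push_kcomp // [RHS]push_kcomp // face_degen_gt.
- move=> n i x lei; apply: val_inj.
  by rewrite [LHS]push_kcomp // [RHS]push_kcomp // face_trot.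
- move=> n x; apply: val_inj.
  by rewrite [LHS]push_kcomp // face_trot0.
- move=> n i x lei; apply: val_inj.
  by rewrite [LHS]push_kcomp // [RHS]push_kcomp // degen_trot.
- move=> n x; apply: val_inj.
  have TTL : lin (kcomp (trot (A := A)) (trot (n := n.+1))) by exact: kcomp_lin.
  by rewrite [LHS]push_kcomp // [RHS]push_kcomp // [RHS]push_kcomp // degen_trot0.
- move=> n x; apply: val_inj; rewrite [LHS]cot_rot_iter.
  by rewrite (funext (@trot_iter_coact k H A n)) push_coaction.
Qed.

End Cyclic.

End CyclicModules.

Theorem theorem3p1 (k : fieldType) (H : hopfAlgebra k) (Sinv : H -> H)
    (antipodeK : cancel (antipode H) Sinv)
    (antipodeVK : cancel Sinv (antipode H))
    (A : comodAlgebra H) :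
  (forall M : rmodComod H, is_rAYD Sinv M -> rstable M ->
    exists (delta : forall n, nat -> {linear homC A M n -> homC A M n.+1})
           (sigma : forall n, nat -> {linear homC A M n.+1 -> homC A M n})
           (tau : forall n, {linear homC A M n -> homC A M n}),
    [/\ (forall n i (f : homC A M n) (a : nat -> A), (i <= n)%N ->
          delta n i f (tpure n.+1 a) = f (tpure n (fmerge i a))),
        (forall n (f : homC A M n) (a : nat -> A),
          delta n n.+1 f (tpure n.+1 a) =
          sweedler (coact A (a n.+1)) (fun b h =>
            ract (f (tpure n (fmulhead b a))) h)),
        (forall n i (f : homC A M n.+1) (a : nat -> A), (i <= n)%N ->
          sigma n i f (tpure n a) = f (tpure n.+1 (finsert1 i a))),
        (forall n (f : homC A M n) (a : nat -> A),
          tau n f (tpure n a) =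
          sweedler (coact A (a n)) (fun b h =>
            ract (f (tpure n (fcons b a))) h))
      & is_cocyclic delta sigma tau])
  /\
  (forall M : lmodComod H, is_lAYD Sinv M -> lstable M ->
    exists (d : forall n, nat -> {linear cotC A M n.+1 -> cotC A M n})
           (s : forall n, nat -> {linear cotC A M n -> cotC A M n.+1})
           (t : forall n, {linear cotC A M n -> cotC A M n}),
    [/\ (forall n i (x : cotC A M n.+1) (r : seq ((nat -> A) * M)), (i <= n)%N ->
          cotensor_val x = \sum_(p <- r) tpure n.+1 p.1 ⊗ p.2 ->
          cotensor_val (d n i x) = \sum_(p <- r) tpure n (fmerge i p.1) ⊗ p.2),
        (forall n (x : cotC A M n.+1) (r : seq ((nat -> A) * M)),
          cotensor_val x = \sum_(p <- r) tpure n.+1 p.1 ⊗ p.2 ->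
          cotensor_val (d n n.+1 x) =
          \sum_(p <- r) sweedler (coact A (p.1 n.+1)) (fun b h =>
            tpure n (fmulhead b p.1) ⊗ lact h p.2)),
        (forall n i (x : cotC A M n) (r : seq ((nat -> A) * M)), (i <= n)%N ->
          cotensor_val x = \sum_(p <- r) tpure n p.1 ⊗ p.2 ->
          cotensor_val (s n i x) =
          \sum_(p <- r) tpure n.+1 (finsert1 i p.1) ⊗ p.2),
        (forall n (x : cotC A M n) (r : seq ((nat -> A) * M)),
          cotensor_val x = \sum_(p <- r) tpure n p.1 ⊗ p.2 ->
          cotensor_val (t n x) =
          \sum_(p <- r) sweedler (coact A (p.1 n)) (fun b h =>
            tpure n (fcons b p.1) ⊗ lact h p.2))
      & is_cyclic d s t]).
Proof.
split=> M MA Ms.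
  exists (hom_face antipodeK antipodeVK A MA), (hom_degen antipodeK antipodeVK A MA),
    (hom_rot antipodeK antipodeVK A MA); split.
  - exact: hom_face_tpure.
  - exact: hom_face_last_tpure.
  - exact: hom_degen_tpure.
  - exact: hom_rot_tpure.
  - exact: hom_cocyclic.
exists (cot_face antipodeK antipodeVK A MA), (cot_degen antipodeK antipodeVK A MA),
  (cot_rot antipodeK antipodeVK A MA); split.
- exact: cot_face_tpure.
- exact: cot_face_last_tpure.
- exact: cot_degen_tpure.
- exact: cot_rot_tpure.
- exact: cot_cyclic.
Qed.
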